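(* Let $k\ge2$ be an integer. (1) Let $(T_1,\dots,T_k)$ be a commuting $k$-tuple of contractions on a Hilbert space $\mathcal H$ and let $T=T_1\cdots T_k$. Assume that the defect space $\mathcal D_T$ is finite-dimensional. If there exists $\sigma\in S_k$ such that the factorization $T=T_{\sigma(1)}T_{\sigma(2)}\cdots T_{\sigma(k)}$ is $k$-regular, then $(T_1,\dots,T_k)$ is symmetric $k$-regular. (2) In the infinite-dimensional setting the implication in (1) fails: there exist a Hilbert space $\mathcal H$ and a commuting $k$-tuple of contractions $(T_1,\dots,T_k)$ on $\mathcal H$, with product $T=T_1\cdots T_k$ and $\dim\mathcal D_T=\infty$, such that $T=T_{\sigma(1)}\cdots T_{\sigma(k)}$ is $k$-regular for some $\sigma\in S_k$ but $(T_1,\dots,T_k)$ is not symmetric $k$-regular. (3) If $(T_1,\dots,T_k)$ is a commuting $k$-tuple of isometries on a Hilbert space $\mathcal H$, then $(T_1,\dots,T_k)$ is symmetric $k$-regular.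
   Context: All Hilbert spaces are complex and separable. For a contraction $A$ on $\mathcal H$, $D_A=(I-A^*A)^{1/2}$ and $\mathcal D_A=\overline{D_A\mathcal H}$. $S_k$ is the symmetric group on $\{1,\dots,k\}$. For a commuting $k$-tuple of contractions $(T_1,\dots,T_k)$ on $\mathcal H$ with product $T=T_1\cdots T_k$ and $\sigma\in S_k$, there is a well-defined isometry $Z_\sigma:\mathcal D_T\to\bigoplus_{r=1}^k\mathcal D_{T_{\sigma(r)}}$ determined by $Z_\sigma(D_Th)=\bigoplus_{r=1}^kD_{T_{\sigma(r)}}T_{\sigma(r+1)}\cdots T_{\sigma(k)}h$, $h\in\mathcal H$ (for $r=k$ the product $T_{\sigma(r+1)}\cdots T_{\sigma(k)}$ is $I_{\mathcal H}$). The factorization $T=T_{\sigma(1)}\cdots T_{\sigma(k)}$ is $k$-regular if $Z_\sigma$ is unitary. The tuple $(T_1,\dots,T_k)$ is symmetric $k$-regular if $T=T_{\sigma(1)}\cdots T_{\sigma(k)}$ is $k$-regular for every $\sigma\in S_k$. *)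

(* Defs.v *)
From HB Require Import structures.
From mathcomp Require Import all_boot all_order all_algebra all_fingroup.
From mathcomp Require Import sesquilinear complex.
From mathcomp Require Import all_classical all_reals all_analysis.
Import Order.TTheory GRing.Theory Num.Theory.
Import numFieldNormedType.Exports.

Set Implicit Arguments.
Unset Strict Implicit.
Unset Printing Implicit Defensive.

Local Open Scope classical_set_scope.
Local Open Scope ring_scope.
Local Open Scope complex_scope.

(* The inner product is linear in its first argument, conjugate-linear in its
   second; the norm of a normedModType over R[i] takes (real) values in R[i]. *)
HB.mixin Record NormedModule_isHilbert (R : realType) H
    & NormedModule R[i] H := {
  inner : {dot H for (@Num.conj R[i])};
  norm_inner : forall x : H, `|x| ^+ 2 = inner x x
}.

#[short(type="hilbertType")]
HB.structure Definition Hilbert (R : realType) :=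
  {H of CompleteNormedModule R[i] H & NormedModule_isHilbert R H}.

Definition separable_space (X : topologicalType) : Prop :=
  exists2 S : set X, countable S & dense S.

Section Operators.
Context {R : realType} {H : hilbertType R}.
Implicit Types (A : {linear H -> H}) (P D : H -> H).

Definition contractive A : Prop := forall x, `|A x| <= `|x|.

Definition isometric A : Prop := forall x, `|A x| = `|x|.

Definition adjoint P : H -> H :=
  get [set B : H -> H | forall x y, inner (P x) y = inner x (B y)].

Definition positive_op D : Prop :=
  [/\ linear D, continuous D & forall x, 0 <= inner (D x) x].

Definition pos_sqrt P : H -> H :=
  get [set D : H -> H | positive_op D /\ D \o D = P].

Definition defect_op P : H -> H :=
  pos_sqrt (fun x => x - adjoint P (P x)).

Definition defect_space P : set H := closure (range (defect_op P)).

Definition finite_dim (K : set H) : Prop :=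
  exists (n : nat) (e : 'I_n -> H),
    K = [set \sum_(i < n) c i *: e i | c in [set: 'I_n -> R[i]]].

End Operators.

Section Tuples.
Context {R : realType} {H : hilbertType R} {k : nat}.
Implicit Types (T : 'I_k -> {linear H -> H}) (s : 'S_k).

(* Elements of a direct sum of k subspaces of H are families 'I_k -> H, with
   squared norm the sum of the squared norms of the components. *)
Definition dsum (L : 'I_k -> set H) : set ('I_k -> H) :=
  [set u | forall r, L r (u r)].

Definition isometry_on (K : set H) (L : set ('I_k -> H))
    (U : H -> 'I_k -> H) : Prop :=
  [/\ forall x, K x -> L (U x),
      forall (c : R[i]) x y, K x -> K y ->
        forall r, U (c *: x + y) r = c *: U x r + U y r
    & forall x, K x -> \sum_(r < k) `|U x r| ^+ 2 = `|x| ^+ 2].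

Definition unitary_on (K : set H) (L : set ('I_k -> H))
    (U : H -> 'I_k -> H) : Prop :=
  isometry_on K L U /\ set_surj K L U.

Definition commuting T : Prop :=
  forall i j x, T i (T j x) = T j (T i x).

Definition prod_op T : H -> H :=
  \big[comp/idfun]_(i < k) (T i : H -> H).

(* T_{s(r+1)} ... T_{s(k)} *)
Definition tail_op T s (r : 'I_k) : H -> H :=
  \big[comp/idfun]_(j < k | (r < j)%N) (T (s j) : H -> H).

Definition defect_sum T s : set ('I_k -> H) :=
  dsum (fun r => defect_space (T (s r))).

(* The values of Z_op T s outside defect_space (prod_op T) are irrelevant; on
   that space it is determined by its values on the range of the defect
   operator. *)
Definition Z_op T s : H -> 'I_k -> H :=
  get [set Z : H -> 'I_k -> H |
    isometry_on (defect_space (prod_op T)) (defect_sum T s) Z /\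
    forall h r,
      Z (defect_op (prod_op T) h) r = defect_op (T (s r)) (tail_op T s r h)].

Definition regular_factorization T s : Prop :=
  unitary_on (defect_space (prod_op T)) (defect_sum T s) (Z_op T s).

Definition symmetric_regular T : Prop :=
  forall s : 'S_k, regular_factorization T s.

End Tuples.

(* Main.v *)
Require Import Defs.
From HB Require Import structures.
From mathcomp Require Import all_boot all_order all_algebra all_fingroup.
From mathcomp Require Import sesquilinear complex.
From mathcomp Require Import all_classical all_reals all_analysis.
From mathcomp Require Import ring lra.

(** For a commuting tuple of contractions with product T, the defining identity
    |D_A x|^2 = |x|^2 - |A x|^2 of a defect operator telescopes along any order
    of the factors ([sum_defect]): the squared norms of the components of
    Z_s (D_T h) add up to |D_T h|^2. Hence Z_s is well defined and isometric on
    the range of D_T, and extends to its closure, the defect space of T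
    ([isometric_extension], [Z_op_spec]). The only question is whether Z_s is
    onto.

    In finite dimension, permuting the summands turns Z_t into an isometry from
    the defect space to the target of Z_s. If Z_s is unitary, composing with its
    inverse gives an injective linear endomorphism of the defect space, which is
    onto when that space is finite-dimensional
    ([spanned_by_injective_surjective]); so Z_t is onto.
    For isometries all the defect spaces vanish and there is nothing to prove.

    In infinite dimension take T_1 = 0 and T_2 = ... = T_k = S with S a
    non-surjective isometry, namely the shift of square-summable sequences.
    Then the defect space is the whole space, the only non-zero summand is the
    one of T_1, and the component of Z_s there is, up to a unitary, the product
    of the operators placed to the right of T_1. With T_1 last this product is empty
    and Z_s is unitary; with T_1 first it is S^(k-1), whose range is proper.

    Adjoints and defect operators are specified by a choice among the operators
    with the right property, so their existence has to be established: adjoints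
    come from the Riesz representation theorem ([riesz]), square roots from the
    iteration Y <- (K + Y^2) / 2, whose limit Y satisfies (I - Y)^2 = I - K
    ([positive_sqrt_exists]). Any positive square root is self-adjoint, which is
    what the norm identity above rests on ([rnorm_defect_op]). *)

Import Order.TTheory GRing.Theory Num.Theory.
Import numFieldNormedType.Exports.

Set Implicit Arguments.
Unset Strict Implicit.
Unset Printing Implicit Defensive.

Local Open Scope classical_set_scope.
Local Open Scope ring_scope.
Local Open Scope complex_scope.

(** * Real-valued norm and inner product *)

Section RealNorm.
Context {R : realType} {H : hilbertType R}.
Implicit Types x y z : H.

Definition rnorm x : R := complex.Re `|x|.
Definition rinner x y : R := complex.Re (inner x y).

(** Norms over R[i] are complex numbers that happen to be real; working with
    their real part gives access to the ordered-field theory of R. *)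
Lemma normE x : `|x| = (rnorm x)%:C.
Proof. by rewrite RRe_real// ger0_real. Qed.

Lemma rnorm_ge0 x : 0 <= rnorm x.
Proof. by rewrite -ler0c -normE. Qed.

Lemma rnormD x y : rnorm (x + y) <= rnorm x + rnorm y.
Proof. by rewrite -lecR rmorphD/= -!normE ler_normD. Qed.

Lemma rnormZ (c : R[i]) x : rnorm (c *: x) = complex.Re `|c| * rnorm x.
Proof.
apply: complexI; rewrite -normE normrZ rmorphM/= -normE; congr (_ * _).
Qed.

Lemma rnormN x : rnorm (- x) = rnorm x.
Proof. by rewrite /rnorm normrN. Qed.

Lemma rnormBC x y : rnorm (x - y) = rnorm (y - x).
Proof. by rewrite /rnorm distrC. Qed.

Lemma rnorm0 : rnorm 0 = 0.
Proof. by rewrite /rnorm normr0. Qed.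

Lemma rnorm_eq0 x : rnorm x = 0 -> x = 0.
Proof. by move=> x0; apply/normr0_eq0; rewrite normE x0. Qed.

Lemma ler_rnorm x y : (`|x| <= `|y|) = (rnorm x <= rnorm y).
Proof. by rewrite !normE lecR. Qed.

Lemma eqr_rnorm x y : (`|x| = `|y|) <-> (rnorm x = rnorm y).
Proof. by rewrite !normE; split=> [/complexI|->]. Qed.

Lemma innerC x y : inner x y = (inner y x)^*.
Proof. by rewrite [LHS]hermC expr0 mul1r. Qed.

Lemma rinnerC x y : rinner x y = rinner y x.
Proof. by rewrite /rinner innerC; case: (inner y x). Qed.

Lemma rinnerDl x y z : rinner (x + y) z = rinner x z + rinner y z.
Proof. by rewrite /rinner linearDl raddfD. Qed.

Lemma rinnerNl x z : rinner (- x) z = - rinner x z.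
Proof. by rewrite /rinner linearNl raddfN. Qed.

Lemma rinnerBl x y z : rinner (x - y) z = rinner x z - rinner y z.
Proof. by rewrite rinnerDl rinnerNl. Qed.

Lemma rinnerZl (a : R) x z : rinner (a%:C *: x) z = a * rinner x z.
Proof.
rewrite /rinner linearZl_LR /=.
by case: (inner _ _) => b c /=; rewrite mul0r subr0.

Qed.

Lemma rinner0l z : rinner 0 z = 0.
Proof. by rewrite /rinner linear0l. Qed.

Lemma rinnerDr z x y : rinner z (x + y) = rinner z x + rinner z y.
Proof. by rewrite !(rinnerC z) rinnerDl. Qed.

Lemma rinnerNr z x : rinner z (- x) = - rinner z x.
Proof. by rewrite !(rinnerC z) rinnerNl. Qed.

Lemma rinnerBr z x y : rinner z (x - y) = rinner z x - rinner z y.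
Proof. by rewrite !(rinnerC z) rinnerBl. Qed.

Lemma rinnerZr (a : R) z x : rinner z (a%:C *: x) = a * rinner z x.
Proof. by rewrite !(rinnerC z) rinnerZl. Qed.

Lemma rinnerxx x : rinner x x = rnorm x ^+ 2.
Proof. by rewrite /rinner -norm_inner normE -rmorphXn. Qed.

Lemma rnormD_sqr x y :
  rnorm (x + y) ^+ 2 = rnorm x ^+ 2 + 2 * rinner x y + rnorm y ^+ 2.
Proof. by rewrite -!rinnerxx rinnerDl !rinnerDr (rinnerC y x); ring. Qed.

Lemma rnormB_sqr x y :
  rnorm (x - y) ^+ 2 = rnorm x ^+ 2 - 2 * rinner x y + rnorm y ^+ 2.
Proof. by rewrite rnormD_sqr rnormN rinnerNr; ring. Qed.

(** The norm is part of the structure, so its triangle inequality is available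
    and yields the Cauchy-Schwarz inequality on squaring. *)
Lemma rinner_le x y : rinner x y <= rnorm x * rnorm y.
Proof.
have : rnorm (x + y) ^+ 2 <= (rnorm x + rnorm y) ^+ 2.
  by rewrite ler_sqr ?nnegrE ?addr_ge0 ?rnorm_ge0// rnormD.
rewrite rnormD_sqr; lra.
Qed.

Lemma Im_inner x y : complex.Im (inner x y) = - rinner ('i *: x) y.
Proof.
rewrite /rinner linearZl_LR /=.
by case: (inner _ _) => a b /=; ring.
Qed.

(** The complex inner product is recovered from its real part by polarization,
    since Im <x, y> = - Re <i x, y>. *)
Lemma inner_eqP x x' y y' :
  rinner x y = rinner x' y' -> rinner ('i *: x) y = rinner ('i *: x') y' ->
  inner x y = inner x' y'.
Proof.
move=> re im; apply/eqP; rewrite eq_complex !Im_inner im eqxx andbT.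
exact/eqP.
Qed.

Lemma rinner_inj y y' : (forall x, rinner x y = rinner x y') -> y = y'.
Proof.
move=> e; apply/eqP; rewrite -subr_eq0; apply/eqP/rnorm_eq0/eqP.
by rewrite -sqrf_eq0 -rinnerxx rinnerBr e subrr.
Qed.

Lemma cvg_rnormP (u : nat -> H) (l : H) :
  u n @[n --> \oo] --> l <-> rnorm (u n - l) @[n --> \oo] --> (0 : R).
Proof.
split=> [/cvgrPdist_lt ul|/cvgrPdist_lt ul].
  apply/cvgrPdist_lt => e e0.
  have /ul : 0 < e%:C by rewrite ltcR.
  apply: filterS => n; rewrite normE ltcR sub0r normrN ger0_norm ?rnorm_ge0//.
  by rewrite rnormBC.
apply/cvgrPdist_lt => -[e e'] /[!ltcE]/= /andP[/eqP -> e0].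
have := ul _ e0; apply: filterS => n.
by rewrite sub0r normrN ger0_norm ?rnorm_ge0// normE rnormBC ltcR.
Qed.

Lemma cvg_rnorm_le (u : nat -> H) (l : H) (a : nat -> R) :
  (forall n, rnorm (u n - l) <= a n) -> a n @[n --> \oo] --> 0 ->
  u n @[n --> \oo] --> l.
Proof.
move=> ua a0; apply/cvg_rnormP; apply: (squeeze_cvgr _ (@cvg_cst _ _ _ _ _)) a0.
by apply: nearW => n; rewrite rnorm_ge0 ua.
Qed.

Lemma cauchy_seq_cvg (u : nat -> H) :
  (forall e : R, 0 < e ->
     exists N, forall n, (N <= n)%N -> rnorm (u n - u N) < e) ->
  exists l : H, u n @[n --> \oo] --> l.
Proof.
move=> uC; apply/cvg_ex; apply: cauchy_cvg; apply: cauchy_exP.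
move=> -[e e'] /[!ltcE]/= /andP[/eqP -> e0].
have [N uN] := uC _ e0; exists (u N); near=> n.
rewrite -ball_normE /ball_/= normE rnormBC ltcR; apply: uN.
by near: n; exact: nbhs_infty_ge.
Unshelve. all: by end_near. Qed.

Lemma rnorm_dist x y : `|rnorm x - rnorm y| <= rnorm (x - y).
Proof.
have := rnormD (x - y) y; have := rnormD (y - x) x.
by rewrite !subrK (rnormBC y x) ler_norml; lra.
Qed.

Lemma cvg_rnorm (u : nat -> H) (l : H) :
  u n @[n --> \oo] --> l -> rnorm (u n) @[n --> \oo] --> rnorm l.
Proof.
move=> /cvg_rnormP ul; apply/cvgrPdist_le => e e0.
have /cvgrPdist_lt/(_ _ e0) := ul; apply: filterS => n.
rewrite sub0r normrN ger0_norm ?rnorm_ge0// => /ltW; apply: le_trans.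
by rewrite rnormBC; exact: rnorm_dist.
Qed.

Lemma closure_seq (A : set H) x :
  closure A x <->
  exists2 u : nat -> H, (forall n, A (u n)) & u n @[n --> \oo] --> x.
Proof.
split=> [Ax|[u Au ux]]; last first.
  move=> B Bx; have [N _ uN] : \forall n \near \oo, B (u n) by exact: ux.
  by exists (u N); split => //; apply: uN => /=.
have /choice[u uP] (n : nat) : exists y, A y /\ rnorm (y - x) < n.+1%:R^-1.
  have [y [Ay]] : A `&` ball x (n.+1%:R^-1 : R)%:C !=set0.
    by apply/Ax/nbhsx_ballx; rewrite ltcR.
  by rewrite -ball_normE/= normE ltcR rnormBC; exists y.
exists u => [n|]; first by case: (uP n).
apply: (@cvg_rnorm_le _ _ (fun n => n.+1%:R^-1)).
  by move=> n; case: (uP n) => _ /ltW.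
exact: cvg_harmonic.
Qed.

End RealNorm.

(** * Riesz representation *)

Section Riesz.
Context {R : realType} {H : hilbertType R}.
Implicit Types x y z : H.

Lemma rnormZr (a : R) x : rnorm (a%:C *: x) = `|a| * rnorm x.
Proof. by rewrite rnormZ normc_def/= expr0n addr0 sqrtr_sqr. Qed.

Lemma cvg_rinnerl (u : nat -> H) l x :
  u n @[n --> \oo] --> l -> rinner (u n) x @[n --> \oo] --> rinner l x.
Proof.
move=> /cvg_rnormP ul.
have ul' : rnorm (u n - l) * rnorm x @[n --> \oo] --> (0 : R).
  by rewrite -(mul0r (rnorm x)); apply: cvgM => //; exact: cvg_cst.
apply/cvgrPdist_le => e e0.
have /cvgrPdist_le/(_ _ e0) := ul'; apply: filterS => n.
rewrite sub0r normrN ger0_norm ?mulr_ge0 ?rnorm_ge0//; apply: le_trans.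
rewrite -rinnerBl ler_norml; apply/andP; split.
  by rewrite lerNl -rinnerNl opprB rinner_le.
by rewrite rnormBC rinner_le.
Qed.

(** The first-order condition at a minimum; t = - d / (q + 1) violates the
    hypothesis when d is non-zero. *)
Lemma quadratic_ge0_eq0 (d q : R) : 0 <= q ->
  (forall t, 0 <= 2 * t * d + t ^+ 2 * q) -> d = 0.
Proof.
move=> q0 /(_ (- d / (q + 1))) h; apply/eqP; rewrite -sqrf_eq0.
rewrite eq_le sqr_ge0 andbT -(pmulr_lle0 _ (_ : 0 < q + 1)) ?ltr_wpDl//.
have q1 : q + 1 != 0 by rewrite gt_eqF// ltr_wpDl.
have q1' : 0 <= (q + 1) ^+ 2 by exact: sqr_ge0.
have : 0 <= (2 * (- d / (q + 1)) * d + (- d / (q + 1)) ^+ 2 * q) * (q + 1) ^+ 2.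
  exact: mulr_ge0.
have -> : (2 * (- d / (q + 1)) * d + (- d / (q + 1)) ^+ 2 * q) * (q + 1) ^+ 2
   = - (d ^+ 2 * (q + 1)) - d ^+ 2 by field.
by have := sqr_ge0 d; lra.
Qed.

(** The vector z minimizes J x = |x|^2 - 2 phi x, as J x = |x - z|^2 - |z|^2
    for the z sought. The linear terms cancel in the parallelogram identity
    applied to J, which makes minimizing sequences Cauchy. *)
Lemma riesz (phi : H -> R) (M : R) :
  (forall x y, phi (x + y) = phi x + phi y) ->
  (forall (a : R) x, phi (a%:C *: x) = a * phi x) ->
  (forall x, phi x <= M * rnorm x) ->
  exists z, forall x, phi x = rinner x z.
Proof.
move=> phiD phiZ phiM.
pose J x := rnorm x ^+ 2 - 2 * phi x.
have J_lb x : - M ^+ 2 <= J x.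
  have := sqr_ge0 (rnorm x - M); have := phiM x; rewrite /J; nra.
have J_inf : has_inf (range J).
  by split; [exists (J 0), 0 | exists (- M ^+ 2) => _ [x _ <-]].
set m := inf (range J).
have m_le x : m <= J x by apply: ge_inf; [case: J_inf|exists x].
have /choice[u uP] (n : nat) : exists x, J x < m + n.+1%:R^-1.
  have [|_ [x _ <-] Jx] := @inf_adherent _ (range J) n.+1%:R^-1 _ J_inf.
    by rewrite invr_gt0.
  by exists x.
(* J at the midpoint of x and y is at least the infimum m. *)
have Jpar x y : rnorm (x - y) ^+ 2 <= 2 * (J x - m) + 2 * (J y - m).
  have := m_le (2^-1%:C *: (x + y)).
  rewrite /J phiZ phiD rnormZr exprMn ger0_norm ?invr_ge0//.
  by rewrite rnormB_sqr rnormD_sqr; lra.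
have u_small (e : R) : 0 < e -> exists N, forall n, (N <= n)%N -> J (u n) < m + e.
  move=> e0.
  have /cvgrPdist_lt/(_ _ e0)[N _ hN] := @cvg_harmonic R.
  exists N => n /hN/=; rewrite sub0r normrN ger0_norm ?invr_ge0// => ne.
  by apply: lt_trans (uP n) _; rewrite ltrD2l.
have [z uz] : exists z : H, u n @[n --> \oo] --> z.
  apply: cauchy_seq_cvg => e e0.
  have [|N hN] := u_small (e ^+ 2 / 4); first by rewrite divr_gt0// exprn_gt0.
  exists N => n Nn; rewrite -ltr_sqr ?nnegrE ?rnorm_ge0 ?(ltW e0)//.
  by have := Jpar (u n) (u N); have := hN n Nn; have := hN N (leqnn N); lra.
(* Compare J (u n) with its values on the line through u n in direction x. *)
exists z => x; apply/eqP; rewrite -subr_eq0; apply/eqP.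
apply: (@quadratic_ge0_eq0 _ (rnorm x ^+ 2)); first exact: sqr_ge0.
move=> t.
have lim : n.+1%:R^-1 + 2 * t * (phi x - rinner (u n) x) + t ^+ 2 * rnorm x ^+ 2
    @[n --> \oo] --> 0 + 2 * t * (phi x - rinner z x) + t ^+ 2 * rnorm x ^+ 2.
  apply: cvgD; last exact: cvg_cst.
  apply: cvgD; first exact: cvg_harmonic.
  apply: cvgM; first exact: cvg_cst.
  by apply: cvgB; [exact: cvg_cst|exact: cvg_rinnerl].
rewrite add0r (rinnerC z) in lim.
apply: (cvgr_to_ge lim).
apply: nearW => n.
have := m_le (u n + (- t)%:C *: x); have := uP n.
rewrite /J rnormD_sqr rinnerZr rnormZr exprMn real_normK ?num_real//.
rewrite phiD phiZ sqrrN.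
by move: (n.+1%:R^-1) (m) => v m'; lra.
Qed.

End Riesz.

(** * Adjoints and positive square roots *)

Section DefectOperator.
Context {R : realType} {H : hilbertType R}.
Implicit Types (x y z : H) (A K : {linear H -> H}).

Lemma inner_inj y y' : (forall x, inner x y = inner x y') -> y = y'.
Proof. by move=> e; apply: rinner_inj => x; rewrite /rinner e. Qed.

Lemma Im_innerC x y : complex.Im (inner x y) = - complex.Im (inner y x).
Proof. by rewrite innerC; case: (inner y x). Qed.

Lemma innerPr (a : R[i]) z x y :
  inner z (a *: x + y) = a^* * inner z x + inner z y.
Proof. by rewrite linearDr linearZr_LR. Qed.

Lemma adjoint_exists A : contractive A ->
  exists B : H -> H, forall x y, inner (A x) y = inner x (B y).
Proof.
move=> cA.
suff /choice[B BP] : forall y, exists z, forall x, inner (A x) y = inner x z.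
  by exists B => x y; exact: BP.
move=> y.
have [|a x|x|z zP] := @riesz R H (fun x => rinner (A x) y) (rnorm y).
- by move=> x x'; rewrite linearD rinnerDl.
- by rewrite linearZ_LR rinnerZl.
- rewrite mulrC (le_trans (rinner_le _ _))// ler_wpM2r ?rnorm_ge0//.
  by rewrite -ler_rnorm.
by exists z => x; apply: inner_eqP; rewrite -?linearZ_LR zP.
Qed.

(** Operators such as prod_op T or defect_op A are plain functions; this gives
    access to the theory of bundled linear maps. *)
Lemma linear_map_of (f : H -> H) : linear f ->
  exists g : {linear H -> H}, (g : H -> H) = f.
Proof.
move=> fl; pose fM := GRing.isLinear.Build _ _ _ _ f fl.
pose g : {linear H -> H} := HB.pack f fM.
by exists g.
Qed.

Section SquareRoot.
Variable K : {linear H -> H}.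
Hypothesis Ksym : forall x y, inner (K x) y = inner x (K y).
Hypothesis K1 : forall x, rnorm (K x) <= rnorm x.

(** Iteration for the solution of Y = (K + Y^2) / 2, that is, of
    (I - Y)^2 = I - K. *)
Fixpoint sqrt_iter n x : H :=
  if n is n'.+1 then (2^-1)%:C *: (K x + sqrt_iter n' (sqrt_iter n' x)) else 0.

(** The same iteration on scalars, with K replaced by its norm bound 1; it
    dominates the operator iteration and, being increasing and bounded by 1,
    forces it to converge. *)
Fixpoint sqrt_bound n : R :=
  if n is n'.+1 then 2^-1 * (1 + sqrt_bound n' ^+ 2) else 0.

Local Notation Y := sqrt_iter.
Local Notation c := sqrt_bound.

Lemma sqrt_bound_itv n : 0 <= c n <= 1.
Proof. by elim: n => [|n IH]/=; [lra|nra]. Qed.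

Lemma sqrt_bound_le m n : (m <= n)%N -> c m <= c n.
Proof.
move=> mn; apply: (@homo_leq _ c <=%O) mn => //; first exact: le_trans.
by move=> {}n /=; have := sqrt_bound_itv n; nra.
Qed.

Lemma sqrt_iter_linear n : linear (Y n).
Proof.
elim: n => [|n IH] a x y /=; first by rewrite scaler0 addr0.
by rewrite linearP !IH addrACA -(scalerDr a) (scalerDr 2^-1%:C) !scalerA mulrC.
Qed.

Lemma sqrt_iterB n x y : Y n (x - y) = Y n x - Y n y.
Proof.
have [g gE] := linear_map_of (sqrt_iter_linear n).
by rewrite -gE linearB.
Qed.

Lemma sqrt_iter_sym n x y : rinner (Y n x) y = rinner x (Y n y).
Proof.
elim: n x y => [|n IH] x y /=; first by rewrite rinner0l rinnerC rinner0l.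
by rewrite rinnerZl rinnerZr rinnerDl rinnerDr !IH /rinner Ksym.
Qed.

Lemma sqrt_iter_le n x : rnorm (Y n x) <= c n * rnorm x.
Proof.
elim: n x => [|n IH] x /=; first by rewrite rnorm0 mul0r.
rewrite rnormZr ger0_norm ?invr_ge0// -mulrA ler_wpM2l ?invr_ge0//.
rewrite (le_trans (rnormD _ _))// mulrDl mul1r lerD// (le_trans (IH _))//.
rewrite expr2 -mulrA ler_wpM2l//.
by have /andP[] := sqrt_bound_itv n.
Qed.

(** Y_(n+2) - Y_(n+1) = (Y_(n+1)^2 - Y_n^2) / 2 is half of
    Y_(n+1) (Y_(n+1) - Y_n) + (Y_(n+1) - Y_n) Y_n, a splitting that holds
    without commutation; the scalar bounds satisfy the same recursion. *)
Lemma sqrt_iter_step n x :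
  rnorm (Y n.+1 x - Y n x) <= (c n.+1 - c n) * rnorm x.
Proof.
elim: n x => [|n IH] x.
  rewrite /= !subr0 addr0 expr0n addr0 rnormZr ger0_norm ?invr_ge0//.
  by rewrite mulr1 ler_wpM2l ?invr_ge0.
have -> : Y n.+2 x - Y n.+1 x =
    2^-1%:C *: (Y n.+1 (Y n.+1 x - Y n x) + (Y n.+1 (Y n x) - Y n (Y n x))).
  rewrite sqrt_iterB subrKA.
  rewrite -[Y n.+2 x]/(2^-1%:C *: (K x + Y n.+1 (Y n.+1 x))).
  rewrite -[X in _ - X = _]/(2^-1%:C *: (K x + Y n (Y n x))).
  by rewrite -scalerBr opprD addrACA subrr add0r.
rewrite -[c n.+2]/(2^-1 * (1 + c n.+1 ^+ 2)).
rewrite -[X in _ <= (_ - X) * _]/(2^-1 * (1 + c n ^+ 2)).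
rewrite rnormZr ger0_norm ?invr_ge0// -mulrBr -mulrA ler_wpM2l ?invr_ge0//.
rewrite (le_trans (rnormD _ _))//.
have -> : (1 + c n.+1 ^+ 2 - (1 + c n ^+ 2)) * rnorm x =
  c n.+1 * ((c n.+1 - c n) * rnorm x) + (c n.+1 - c n) * (c n * rnorm x) by ring.
have /andP[c0 _] := sqrt_bound_itv n.+1.
have cc : 0 <= c n.+1 - c n by rewrite subr_ge0 sqrt_bound_le.
apply: lerD.
  by rewrite (le_trans (sqrt_iter_le _ _))// ler_wpM2l.
by rewrite (le_trans (IH _))// ler_wpM2l// sqrt_iter_le.
Qed.

Lemma sqrt_iter_dist m n x : (m <= n)%N ->
  rnorm (Y n x - Y m x) <= (c n - c m) * rnorm x.
Proof.
elim: n => [|n IH]; first by rewrite leqn0 => /eqP->; rewrite !subrr rnorm0 mul0r.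
rewrite leq_eqVlt => /predU1P[->|]; first by rewrite !subrr rnorm0 mul0r.
rewrite ltnS => /IH{}IH.
rewrite -(subrK (Y n x) (Y n.+1 x)) -addrA (le_trans (rnormD _ _))//.
rewrite -(subrK (c n) (c n.+1)) -[X in _ <= X * _]addrA mulrDl.
by rewrite lerD// sqrt_iter_step.
Qed.

Lemma sqrt_iter_cvg x : exists l : H, Y n x @[n --> \oo] --> l.
Proof.
apply: cauchy_seq_cvg => e e0.
have csup : has_sup (range c).
  by split; [exists (c 0%N), 0%N | exists 1 => _ [n _ <-]; case/andP: (sqrt_bound_itv n)].
have x1 : 0 < rnorm x + 1 by rewrite ltr_wpDl// rnorm_ge0.
have [|_ [N _ <-] cN] := @sup_adherent _ (range c) (e / (rnorm x + 1)) _ csup.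
  by rewrite divr_gt0.
exists N => n Nn; apply: le_lt_trans (sqrt_iter_dist _ Nn) _.
have cn : c n <= sup (range c).
  by apply: ub_le_sup; [case: csup|exists n].
have d0 : 0 <= c n - c N by rewrite subr_ge0 sqrt_bound_le.
have de : c n - c N < e / (rnorm x + 1) by lra.
move: de; rewrite ltr_pdivlMr// => de; apply: le_lt_trans de.
by rewrite ler_wpM2l// lerDl.
Qed.

Lemma positive_sqrt_exists :
  exists D : H -> H, positive_op D /\ D \o D = (fun x => x - K x).
Proof.
have /choice[S SP] := sqrt_iter_cvg.
have S1 x : rnorm (S x) <= rnorm x.
  apply: (cvgr_to_le (cvg_rnorm (SP x))).
  apply: nearW => n; rewrite (le_trans (sqrt_iter_le _ _))//.
  have /andP[_ cn] := sqrt_bound_itv n.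
  by rewrite ler_piMl// rnorm_ge0.
have Slin : linear S.
  move=> a x y.
  have : Y n (a *: x + y) @[n --> \oo] --> a *: S x + S y.
    under eq_fun do rewrite sqrt_iter_linear.
    by apply: cvgD; [apply: cvgZr; exact: SP|exact: SP].
  exact: (cvg_unique (@norm_hausdorff _ _)) (SP _).
have [S' S'E] := linear_map_of Slin.
have SB x y : S (x - y) = S x - S y by rewrite -S'E linearB.
have Ssym x y : rinner (S x) y = rinner x (S y).
  have /cvg_lim <-// := cvg_rinnerl (x := y) (SP x).
  rewrite rinnerC; have /cvg_lim <-// := cvg_rinnerl (x := x) (SP y).
  by under eq_fun do rewrite sqrt_iter_sym rinnerC.
have SS x : S x = 2^-1%:C *: (K x + S (S x)).
  have lim2 : Y n (Y n x) @[n --> \oo] --> S (S x).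
    have /cvg_rnormP l1 := SP x; have /cvg_rnormP l2 := SP (S x).
    apply: (@cvg_rnorm_le _ _ _ _ (fun n => rnorm (Y n x - S x) + rnorm (Y n (S x) - S (S x)))); last first.
      by rewrite -[0 in X in _ --> X](addr0 0); apply: cvgD.
    move=> n; rewrite -(subrK (Y n (S x)) (Y n (Y n x))) -addrA.
    rewrite (le_trans (rnormD _ _))// lerD2r -sqrt_iterB.
    rewrite (le_trans (sqrt_iter_le _ _))//.
    have /andP[_ cn] := sqrt_bound_itv n.
    by rewrite ler_piMl// rnorm_ge0.
  have lim3 : Y n.+1 x @[n --> \oo] --> 2^-1%:C *: (K x + S (S x)).
    by apply: cvgZr; apply: cvgD => //; exact: cvg_cst.
  apply: (cvg_unique (@norm_hausdorff _ _)) lim3.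
  by have := SP x; rewrite -(cvg_shiftS (fun n => Y n x)).
exists (fun x => x - S x); split; last first.
  apply/funext => x /=; rewrite SB.
  have e : S x + S x = K x + S (S x).
    rewrite {1 2}(SS x) -scalerDl -rmorphD/= -[RHS]scale1r.
    by congr (_ *: _); rewrite -div1r -splitr.
  have -> : x - S x - (S x - S (S x)) = x - (S x + S x - S (S x)).
    by rewrite !opprD opprK !addrA.
  by rewrite e addrK.
split.
- by move=> a x y; rewrite Slin scalerBr opprD addrACA.
- move=> x; apply/cvgrPdist_lt => -[e e'] /[!ltcE]/= /andP[/eqP -> e0].
  near=> y; rewrite normE ltcR.
  have -> : x - S x - (y - S y) = (x - y) - S (x - y).
    by rewrite SB !opprD !opprK addrACA.
  have xy : rnorm (x - y) < e / 2.
    near: y; have := nbhsx_ballx x ((e / 2)%:C); rewrite ltcR divr_gt0// => /(_ isT).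
    by apply: filterS => y; rewrite -ball_normE/= normE ltcR.
  have := rnormD (x - y) (- S (x - y)); rewrite rnormN.
  by have := S1 (x - y); lra.
- move=> x; rewrite lecE; apply/andP; split.
    rewrite Im_inner/= scalerBr rinnerBl oppr_eq0 subr_eq0; apply/eqP.
    have ix : rinner ('i *: x) x = 0.
      by have := Im_innerC x x; rewrite Im_inner; lra.
    have := Im_innerC (S x) x; rewrite !Im_inner -Ssym -S'E linearZ_LR /=.
    by rewrite ix; lra.
  rewrite -[leRHS]/(rinner (x - S x) x) rinnerBl rinnerxx.
  by have := rinner_le (S x) x; have := S1 x; have := rnorm_ge0 x; rewrite /=; nra.
Unshelve. all: by end_near. Qed.

End SquareRoot.
End DefectOperator.

(** * The norm of a defect operator *)

Section DefectNorm.
Context {R : realType} {H : hilbertType R}.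
Implicit Types (x y z : H).

(** On a complex space a positive operator is self-adjoint: the quadratic form
    is real, hence Im <D u, v> = Im <u, D v> by polarization, and replacing u by
    i u gives the real parts. *)
Lemma positive_op_sym (D : H -> H) x y : positive_op D ->
  rinner (D x) y = rinner x (D y).
Proof.
move=> [Dl _ D0]; have [D' D'E] := linear_map_of Dl.
have Im0 z : complex.Im (inner (D z) z) = 0 by exact: ger0_Im (D0 z).
have DD u v : D (u + v) = D u + D v by rewrite -D'E linearD.
have ImD u v : complex.Im (inner (D u) v) = complex.Im (inner u (D v)).
  rewrite (Im_innerC u); have := Im0 (u + v).
  rewrite DD linearDl !linearDr !raddfD /=.
  by have := Im0 u; have := Im0 v; lra.
have ii z : 'i *: ('i *: z) = - z by rewrite scalerA -expr2 sqr_i scaleN1r.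
have := ImD ('i *: x) y; rewrite -{1}D'E linearZ_LR D'E !Im_inner !ii !rinnerNl.
by rewrite !opprK.
Qed.

Variable A : H -> H.
Hypothesis Al : linear A.
Hypothesis A1 : forall x, rnorm (A x) <= rnorm x.

(** Both choices behind defect_op A have a witness: the adjoint, and a positive
    square root of I - A* A, where A* A is a self-adjoint contraction. *)
Lemma defect_op_spec : positive_op (defect_op A) /\
  forall x y, rinner (defect_op A (defect_op A x)) y = rinner x y - rinner (A x) (A y).
Proof.
have [g gE] := linear_map_of Al.
have adjP x y : inner (A x) y = inner x (adjoint A y).
  have [|B BP] := @adjoint_exists _ _ g; first by move=> z; rewrite gE ler_rnorm.
  have /getPex : exists B, [set B : H -> H | forall x y, inner (A x) y = inner x (B y)] B.
    by exists B => u v; rewrite -gE BP.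
  exact.
pose K x := adjoint A (A x).
have Kin x y : inner x (K y) = inner (A x) (A y) by rewrite -adjP.
have Kl : linear K.
  move=> a x y; apply: inner_inj => z.
  by rewrite innerPr !Kin -gE linearP innerPr.
have [K' K'E] := linear_map_of Kl.
have [||D [D0 DD]] := @positive_sqrt_exists _ _ K'.
- by move=> x y; rewrite K'E Kin innerC Kin -innerC.
- move=> x; rewrite K'E; have [->|Kx0] := eqVneq (rnorm (K x)) 0.
    exact: rnorm_ge0.
  have Kx_gt0 : 0 < rnorm (K x) by rewrite lt_def Kx0 rnorm_ge0.
  rewrite -(ler_pM2l Kx_gt0) -expr2 -rinnerxx {2}/K /rinner -adjP.
  by rewrite (le_trans (rinner_le _ _))// ler_pM ?rnorm_ge0.
have /getPex [H1 H2] : exists D, [set D : H -> H | positive_op D /\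
    D \o D = (fun x => x - adjoint A (A x))] D.
  by exists D; split => //; rewrite DD K'E.
split => // x y.
have -> : defect_op A (defect_op A x) = x - K x by exact: (congr1 (@^~ x) H2).
by rewrite rinnerBl [rinner (K x) y]rinnerC [rinner (A x) _]rinnerC /rinner Kin.
Qed.

Lemma defect_op_linear : linear (defect_op A).
Proof. by case: defect_op_spec => -[]. Qed.

Lemma rnorm_defect_op x :
  rnorm (defect_op A x) ^+ 2 = rnorm x ^+ 2 - rnorm (A x) ^+ 2.
Proof.
have [D0 DD] := defect_op_spec.
by rewrite -rinnerxx -(positive_op_sym _ _ D0) DD !rinnerxx.
Qed.

Hypothesis A_isometric : forall x, rnorm (A x) = rnorm x.

Lemma defect_op_isometric x : defect_op A x = 0.
Proof.
apply: rnorm_eq0; apply/eqP.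
by rewrite -sqrf_eq0 rnorm_defect_op A_isometric subrr.
Qed.

Lemma defect_space_isometric y : defect_space A y -> y = 0.
Proof.
move=> /closure_seq[v v0 vy].
have {}v0 : v = fun=> 0.
  by apply/funext => n; have [h _ <-] := v0 n; rewrite defect_op_isometric.
move: vy; rewrite v0 => vy.
by apply: (cvg_unique (@norm_hausdorff _ H) vy); exact: cvg_cst.
Qed.

End DefectNorm.

(** * Products of commuting operators *)

Section CommutingProducts.
Context {R : realType} {H : hilbertType R} {I : eqType}.
Variable T : I -> {linear H -> H}.
Implicit Types l : seq I.

Local Notation compl l := (\big[comp/idfun]_(i <- l) (T i : H -> H)).

Lemma comp_seq_linear l : linear (compl l).
Proof.
elim: l => [|i l IH] a x y; first by rewrite big_nil.
by rewrite big_cons /= IH linearP.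
Qed.

Lemma comp_seq_contractive l : (forall i, contractive (T i)) ->
  forall x, rnorm (compl l x) <= rnorm x.
Proof.
move=> T1; elim: l => [|i l IH] x; first by rewrite big_nil.
rewrite big_cons /=; apply: le_trans (IH x); rewrite -ler_rnorm.
exact: T1.
Qed.

Lemma comp_seq_cat l1 l2 x : compl (l1 ++ l2) x = compl l1 (compl l2 x).
Proof.
elim: l1 => [|i l1 IH]; first by rewrite cat0s [in RHS]big_nil.
by rewrite /= !big_cons /= IH.
Qed.

Hypothesis Tcomm : forall i j x, T i (T j x) = T j (T i x).

Lemma comp_seqC1 i l x : T i (compl l x) = compl l (T i x).
Proof.
elim: l x => [|j l IH] x; first by rewrite big_nil.
by rewrite big_cons /= Tcomm IH.
Qed.

Lemma comp_seqC l1 l2 x : compl l1 (compl l2 x) = compl l2 (compl l1 x).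
Proof.
elim: l1 x => [|i l IH] x; first by rewrite big_nil.
by rewrite [compl (i :: l)]big_cons /= IH comp_seqC1.
Qed.

(** With this, every reordering of the factors of T is a statement about
    permuting lists. *)
Lemma comp_seq_perm l1 l2 : perm_eq l1 l2 -> compl l1 = compl l2.
Proof.
move=> l12; suff : compl l1 =1 compl l2 by move/funext.
apply: (catCA_perm_ind _ l12 (P := fun l => compl l1 =1 compl l)) => //.
move=> s1 s2 s3 h x; rewrite h !comp_seq_cat.
by rewrite comp_seqC.
Qed.

End CommutingProducts.

(** * Extending isometries to a closure *)

Section IsometricExtension.
Context {R : realType} {H : hilbertType R} {k : nat}.

Lemma closure_range_seq (D : H -> H) x : closure (range D) x ->
  exists u : nat -> H, D (u n) @[n --> \oo] --> x.
Proof.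
move=> /closure_seq[v Dv vx].
have /choice[w wv] : forall n, exists h, D h = v n.
  by move=> n; have [h _ hv] := Dv n; exists h.
by exists w; under eq_fun do rewrite wv.
Qed.

(** The value of the extension at x is the limit of C (u n) along any u with
    D (u n) --> x. It exists, and does not depend on u, because C is dominated
    by D. Outside the closure of the range of D there is no such u and any y
    will do. *)
Lemma cvg_isometric_extension (D C : {linear H -> H}) :
  (forall h, rnorm (C h) <= rnorm (D h)) ->
  forall x : H, exists y : H, forall u : nat -> H,
    D (u n) @[n --> \oo] --> x -> C (u n) @[n --> \oo] --> y.
Proof.
move=> CD x; have [Dx|Dx] := pselect (closure (range D) x); last first.
  exists 0 => u ux; case: Dx; apply/closure_seq; exists (D \o u) => //.
have [w wx] := closure_range_seq Dx.
have [y wy] : exists y : H, C (w n) @[n --> \oo] --> y.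
  apply: cauchy_seq_cvg => e e0.
  have e20 : 0 < e / 2 by rewrite divr_gt0.
  have /cvg_rnormP/cvgrPdist_lt/(_ _ e20)[N _ vN] := wx.
  exists N => n Nn; rewrite -linearB; apply: le_lt_trans (CD _) _.
  rewrite linearB.
  have := vN n Nn; have := vN N (leqnn N); rewrite /= !sub0r !normrN.
  rewrite !(ger0_norm (rnorm_ge0 _)).
  have := rnormD (D (w n) - x) (x - D (w N)); rewrite subrKA (rnormBC x).
  by lra.
exists y => u ux.
have /cvg_rnormP l1 := ux; have /cvg_rnormP l2 := wx; have /cvg_rnormP l3 := wy.
apply: (@cvg_rnorm_le _ _ _ _ (fun n => rnorm (D (u n) - x) + rnorm (D (w n) - x)
   + rnorm (C (w n) - y))); last first.
  by rewrite -[0 in X in _ --> X](addr0 0) -[0 in X in X + _](addr0 0);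
     apply: cvgD => //; apply: cvgD.
move=> n; rewrite -(subrK (C (w n)) (C (u n))) -addrA.
rewrite (le_trans (rnormD _ _))// lerD2r -linearB (le_trans (CD _))//.
by rewrite linearB -(subrKA x) (le_trans (rnormD _ _))// lerD2l rnormBC.
Qed.

(** Quantifying over all approximating sequences makes linearity and the norm
    identity plain limits of the same facts on the range of D. *)
Lemma isometric_extension (D : {linear H -> H}) (C : 'I_k -> {linear H -> H})
    (A : 'I_k -> set H) :
  (forall h, \sum_(r < k) rnorm (C r h) ^+ 2 = rnorm (D h) ^+ 2) ->
  (forall r h, A r (C r h)) ->
  exists Z, isometry_on (closure (range D)) (dsum (fun r => closure (A r))) Z /\
    forall h r, Z (D h) r = C r h.
Proof.
move=> CD AC.
have CrD r h : rnorm (C r h) <= rnorm (D h).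
  rewrite -ler_sqr ?nnegrE ?rnorm_ge0// -CD (bigD1 r)//= lerDl.
  by apply: sumr_ge0 => i _; exact: sqr_ge0.
have /choice[Z ZP] : forall x : H, exists y : 'I_k -> H, forall r (u : nat -> H),
    D (u n) @[n --> \oo] --> x -> C r (u n) @[n --> \oo] --> y r.
  move=> x.
  have /choice[y yP] r := cvg_isometric_extension (CrD r) x.
  by exists y.
exists Z; split; last first.
  move=> h r.
  have lim : (fun=> C r h) @ \oo --> Z (D h) r.
    by apply: (ZP _ _ (fun=> h)); exact: cvg_cst.
  by apply: (cvg_unique (@norm_hausdorff _ H) lim); exact: cvg_cst.
split.
- move=> x /closure_range_seq[u ux] r; apply/closure_seq; exists (C r \o u); last exact: ZP.
  by move=> n; exact: AC.
- move=> c x y /closure_range_seq[u ux] /closure_range_seq[v vy] r.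
  have lim1 : D (c *: u n + v n) @[n --> \oo] --> c *: x + y.
    under eq_fun do rewrite linearP.
    by apply: cvgD => //; exact: cvgZr.
  have := ZP _ r _ lim1; under eq_fun do rewrite linearP.
  move=> lim2; apply: (cvg_unique (@norm_hausdorff _ _)) lim2 _.
  by apply: cvgD; [apply: cvgZr|]; exact: ZP.
- move=> x /closure_range_seq[u ux].
  have lim1 : \sum_(r < k) rnorm (C r (u n)) ^+ 2 @[n --> \oo] -->
      \sum_(r < k) rnorm (Z x r) ^+ 2.
    apply: cvg_big => [|r _]; first exact: add_continuous.
    by apply: cvgM; apply: cvg_rnorm; exact: ZP.
  have lim2 : rnorm (D (u n)) ^+ 2 @[n --> \oo] --> rnorm x ^+ 2.
    by apply: cvgM; exact: cvg_rnorm.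
  have e : \sum_(r < k) rnorm (Z x r) ^+ 2 = rnorm x ^+ 2.
    move: lim1; under eq_fun do rewrite CD.
    by move=> lim1; exact: (cvg_unique (@Rhausdorff R) lim1 lim2).
  rewrite normE -rmorphXn/= -e rmorph_sum; apply: eq_bigr => r _.
  by rewrite normE -rmorphXn.
Qed.

End IsometricExtension.

(** * Injective endomorphisms in finite dimension *)

Section FiniteDimension.
Context {F : fieldType} {V : lmodType F}.
Implicit Types (K : set V) (x y : V).

Definition spanned_by n (e : 'I_n -> V) : set V :=
  [set \sum_(i < n) c i *: e i | c in [set: 'I_n -> F]].

Lemma spanned_byP n (e : 'I_n -> V) c x y :
  spanned_by e x -> spanned_by e y -> spanned_by e (c *: x + y).
Proof.
move=> [a _ <-] [b _ <-]; exists (fun i => c * a i + b i) => //.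
rewrite scaler_sumr -big_split/=; apply: eq_bigr => i _.
by rewrite scalerDl scalerA.
Qed.

(** Solving a non-trivial relation for the vector e i whose coefficient is
    non-zero. *)
Lemma spanned_by_drop n (e : 'I_n.+1 -> V) c i :
  \sum_(j < n.+1) c j *: e j = 0 -> c i != 0 ->
  spanned_by e = spanned_by (fun j => e (lift i j)).
Proof.
move=> ce ci; apply/seteqP; split=> x [d _ <-].
  exists (fun j => d (lift i j) - d i / c i * c (lift i j)) => //.
  transitivity (\sum_(j < n.+1) (d j - d i / c i * c j) *: e j).
    by rewrite [RHS](bigD1_ord i)//= divfK// subrr scale0r add0r.
  under eq_bigr do rewrite scalerBl -scalerA.
  by rewrite sumrB -scaler_sumr ce scaler0 subr0.
exists (fun j => if unlift i j is Some j' then d j' else 0) => //.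
rewrite (bigD1_ord i)//= unlift_none scale0r add0r.
by apply: eq_bigr => j _; rewrite liftK.
Qed.

Lemma spanned_by_basis n (e : 'I_n -> V) : exists m (b : 'I_m -> V),
  spanned_by e = spanned_by b /\
  forall c, \sum_(i < m) c i *: b i = 0 -> forall i, c i = 0.
Proof.
elim: n e => [|n IH] e; first by exists 0%N, e; split => // c _ [].
have [ind|/existsNP[c /not_implyP[ce /existsNP[i /eqP ci]]]] :=
  pselect (forall c, \sum_(i < n.+1) c i *: e i = 0 -> forall i, c i = 0).
  by exists n.+1, e.
have [m [b [eb bind]]] := IH (fun j => e (lift i j)).
by exists m, b; split => //; rewrite (spanned_by_drop ce ci).
Qed.

(** In a basis, W is given by a square matrix M acting on rows; injectivity
    makes the rows of M independent, hence M invertible. The space is a set of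
    vectors and W is linear on that set only. *)
Lemma spanned_by_injective_surjective n (e : 'I_n -> V) (W : V -> V) :
  let K := spanned_by e in
  (forall x, K x -> K (W x)) ->
  (forall c x y, K x -> K y -> W (c *: x + y) = c *: W x + W y) ->
  (forall x, K x -> W x = 0 -> x = 0) ->
  forall y, K y -> exists2 x, K x & W x = y.
Proof.
have [m [b [-> bind]]] := spanned_by_basis e.
move=> K WK Wlin Winj.
have K0 : K 0.
  by exists (fun=> 0) => //; apply: big1 => i _; rewrite scale0r.
have Kb i : K (b i).
  exists (fun j => (j == i)%:R) => //.
  rewrite (bigD1 i)//= eqxx scale1r big1 ?addr0// => j /negPf ->.
  by rewrite scale0r.
have W0 : W 0 = 0.
  have := Wlin 1 0 0 K0 K0; rewrite scaler0 addr0 scale1r.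
  by rewrite -[X in X = _]addr0 => /addrI.
have Wsum (c : 'I_m -> F) : W (\sum_(i < m) c i *: b i) = \sum_(i < m) c i *: W (b i).
  suff [] : K (\sum_(i < m) c i *: b i) /\
    W (\sum_(i < m) c i *: b i) = \sum_(i < m) c i *: W (b i) by [].
  apply: (big_ind2 (fun x y => K x /\ W x = y)) => //.
  - move=> x1 y1 x2 y2 [Kx1 <-] [Kx2 <-].
    have := spanned_byP 1 Kx1 Kx2; have := Wlin 1 _ _ Kx1 Kx2.
    by rewrite !scale1r.
  - move=> i _; have := spanned_byP (c i) (Kb i) K0; have := Wlin (c i) _ _ (Kb i) K0.
    by rewrite W0 !addr0.
have /choice[A AP] : forall i, exists a : 'I_m -> F, \sum_(j < m) a j *: b j = W (b i).
  by move=> i; have [a _ ab] := WK _ (Kb i); exists a.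
pose M := \matrix_(i < m, j < m) A i j.
have WM (v : 'rV[F]_m) :
    W (\sum_(i < m) v 0 i *: b i) = \sum_(j < m) (v *m M) 0 j *: b j.
  rewrite Wsum.
  under [RHS]eq_bigr do rewrite mxE scaler_suml.
  rewrite exchange_big/=; apply: eq_bigr => i _.
  rewrite -AP scaler_sumr; apply: eq_bigr => j _.
  by rewrite mxE scalerA.
have Mfree : row_free M.
  rewrite -kermx_eq0; apply/eqP/row_matrixP => i; rewrite row0.
  set v := row i _.
  have vM : v *m M = 0 by apply/sub_kermxP; exact: row_sub.
  have vb : \sum_(i < m) v 0 i *: b i = 0.
    apply: Winj; first by exists (v 0).
    by rewrite WM vM; apply: big1 => j _; rewrite mxE scale0r.
  by apply/rowP => j; rewrite (bind _ vb) mxE.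
move=> y [c _ <-].
pose w := \row_j c j *m invmx M.
exists (\sum_(i < m) w 0 i *: b i); first by exists (w 0).
rewrite WM /w mulmxKV -?row_free_unit//.
by apply: eq_bigr => j _; rewrite mxE.
Qed.

End FiniteDimension.

(** * Regular factorizations *)

Section RegularFactorizations.
Context {R : realType} {H : hilbertType R} {k : nat}.
Variable T : 'I_k -> {linear H -> H}.
Hypothesis Tcomm : commuting T.
Implicit Types s t : 'S_k.

Local Notation compl l := (\big[comp/idfun]_(i <- l) (T i : H -> H)).
Local Notation tail_seq s m :=
  (map s (seq.filter (fun j : 'I_k => (m <= j)%N) (index_enum 'I_k))).

Lemma tail_opE s r : tail_op T s r = compl (tail_seq s r.+1).
Proof. by rewrite big_map big_filter. Qed.

Lemma prod_opE s : prod_op T = compl (tail_seq s 0).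
Proof.
apply: comp_seq_perm => //; apply: uniq_perm.
- exact: index_enum_uniq.
- by rewrite map_inj_uniq ?filter_uniq ?index_enum_uniq//; exact: perm_inj.
move=> i; rewrite mem_index_enum; apply/esym/mapP.
by exists (s^-1%g i); rewrite ?mem_filter ?mem_index_enum// permKV.
Qed.

(** Position r comes first among the positions from r on, but the order of the
    factors is immaterial, so comparing the two lists up to permutation is
    enough. *)
Lemma tail_seq_step s (r : 'I_k) :
  compl (tail_seq s r) = T (s r) \o compl (tail_seq s r.+1).
Proof.
rewrite -[RHS](big_cons _ _ _ _ xpredT (fun i => T i : H -> H)).
rewrite -map_cons; apply: comp_seq_perm => //; apply: perm_map; apply: uniq_perm.
- by rewrite filter_uniq ?index_enum_uniq.
- by rewrite /= mem_filter ltnn filter_uniq ?index_enum_uniq.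
move=> i; rewrite inE !mem_filter !mem_index_enum !andbT leq_eqVlt eq_sym.
by rewrite -val_eqE.
Qed.

Lemma tail_seq_end s : tail_seq s k = [::].
Proof.
by rewrite (eq_filter (a2 := pred0)) ?filter_pred0// => i /=; rewrite leqNgt ltn_ord.
Qed.

Hypothesis T1 : forall i, contractive (T i).

Lemma rnorm_contractive i x : rnorm (T i x) <= rnorm x.
Proof. by rewrite -ler_rnorm; exact: T1. Qed.

Lemma prod_op_linear : linear (prod_op T).
Proof. exact: comp_seq_linear. Qed.

Lemma prod_op_contractive x : rnorm (prod_op T x) <= rnorm x.
Proof. exact: comp_seq_contractive. Qed.

(** With a m the squared norm of the product of the factors from position m on,
    applied to h, the r-th term is a (r + 1) - a r; the sum telescopes to
    a k - a 0 = |h|^2 - |T h|^2. *)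
Lemma sum_defect s h :
  \sum_(r < k) rnorm (defect_op (T (s r)) (tail_op T s r h)) ^+ 2 =
  rnorm (defect_op (prod_op T) h) ^+ 2.
Proof.
rewrite rnorm_defect_op; [|exact: prod_op_linear|exact: prod_op_contractive].
pose a m := rnorm (compl (tail_seq s m) h) ^+ 2.
transitivity (\sum_(0 <= m < k) (a m.+1 - a m)).
  rewrite big_mkord; apply: eq_bigr => r _.
  rewrite rnorm_defect_op; [|exact: linearP|exact: rnorm_contractive].
  by rewrite /a tail_seq_step /= tail_opE.
by rewrite telescope_sumr// /a tail_seq_end big_nil (prod_opE s).
Qed.

Lemma Z_op_spec s :
  isometry_on (defect_space (prod_op T)) (defect_sum T s) (Z_op T s) /\
  forall h r,
    Z_op T s (defect_op (prod_op T) h) r = defect_op (T (s r)) (tail_op T s r h).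
Proof.
have [D DE] := linear_map_of (defect_op_linear prod_op_linear prod_op_contractive).
have tailL r : linear (tail_op T s r) by rewrite tail_opE; exact: comp_seq_linear.
have /choice[C CE] : forall r, exists C : {linear H -> H},
    (C : H -> H) = defect_op (T (s r)) \o tail_op T s r.
  move=> r; apply: linear_map_of => a x y /=; rewrite tailL.
  have Dl : linear (defect_op (T (s r))).
    by apply: defect_op_linear; [exact: linearP|exact: rnorm_contractive].
  by rewrite Dl.
have [||Z [Z1 Z2]] := @isometric_extension _ _ k D C (fun r => range (defect_op (T (s r)))).
- move=> h; rewrite DE -(sum_defect s); apply: eq_bigr => r _.
  by rewrite CE.
- by move=> r h; rewrite CE; exists (tail_op T s r h).
apply: (getPex (P := [set Z : H -> 'I_k -> H |
    isometry_on (defect_space (prod_op T)) (defect_sum T s) Z /\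
    forall h r,
      Z (defect_op (prod_op T) h) r = defect_op (T (s r)) (tail_op T s r h)])).
exists Z; split; first by rewrite /defect_space -DE.
by move=> h r; rewrite -DE Z2 CE.
Qed.

Lemma isometry_on_eq0 (K : set H) (L : set ('I_k -> H)) (U : H -> 'I_k -> H) x :
  isometry_on K L U -> K x -> (forall r, U x r = 0) -> x = 0.
Proof.
move=> [_ _ Unorm] Kx U0; apply/normr0_eq0/eqP; rewrite -sqrf_eq0 -Unorm//.
by apply/eqP/big1 => r _; rewrite U0 normr0 expr0n.
Qed.

(** Let p r be the position in the order t of the r-th factor in the order s, so
    that u \o p rearranges an element u of the target of Z_t into one of the
    target of Z_s. Then W x = Z_s^-1 (Z_t x \o p) is an injective endomorphism
    of the defect space; it is onto by finiteness of the dimension, and Z_t is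
    onto with it. *)
Lemma regular_factorization_finite_dim s t :
  finite_dim (defect_space (prod_op T)) ->
  regular_factorization T s -> regular_factorization T t.
Proof.
set K := defect_space _ => -[n [e Ke]] [Zs_iso Zs_surj].
have [Zt_iso _] := Z_op_spec t; split => //.
have [Zs_in Zs_lin Zs_norm] := Zs_iso; have [Zt_in Zt_lin Zt_norm] := Zt_iso.
have KP c x y : K x -> K y -> K (c *: x + y).
  by rewrite Ke; exact: spanned_byP.
pose p r := (t^-1)%g (s r).
have tp r : t (p r) = s r by rewrite permKV.
have defect_sum_p u : defect_sum T t u -> defect_sum T s (u \o p).
  by move=> ut r /=; rewrite -tp.
have /choice[W WP] : forall x, exists y, K x -> K y /\ Z_op T s y = Z_op T t x \o p.
  move=> x; have [Kx|nKx] := pselect (K x); last by exists 0.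
  by have [y Ky <-] := Zs_surj _ (defect_sum_p _ (Zt_in _ Kx)); exists y.
have Zs_inj x y : K x -> K y -> (forall r, Z_op T s x r = Z_op T s y r) -> x = y.
  move=> Kx Ky xy; apply/eqP; rewrite -subr_eq0 addrC -scaleN1r; apply/eqP.
  apply: (isometry_on_eq0 Zs_iso); first exact: KP.
  by move=> r; rewrite Zs_lin// xy scaleN1r addNr.
have p_inj : injective p by move=> r r' /perm_inj/perm_inj.
have [q qp pq] := injF_bij p_inj.
move=> u ut.
have [y Ky yu] := Zs_surj _ (defect_sum_p _ ut).
have [] := @spanned_by_injective_surjective _ _ _ e W _ _ _ y.
- by rewrite -[spanned_by e]Ke => x /WP[].
- rewrite -[spanned_by e]Ke => c x x' Kx Kx'.
  have [KWx Wx] := WP _ Kx; have [KWx' Wx'] := WP _ Kx'.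
  have [KW W'] := WP _ (KP c _ _ Kx Kx').
  apply: Zs_inj => //; first exact: KP.
  by move=> r; rewrite W' Zs_lin// Wx Wx' /= Zt_lin.
- rewrite -[spanned_by e]Ke => x Kx Wx0.
  have [_ Wx] := WP _ Kx; have K0 : K 0 by rewrite -Wx0; case: (WP _ Kx).
  have Z0 r : Z_op T s 0 r = 0.
    have := Zs_lin (-1) _ _ K0 K0 r; rewrite scaler0 addr0 => ->.
    by rewrite scaleN1r addNr.
  apply: (isometry_on_eq0 Zt_iso Kx) => r.
  by rewrite -(pq r) -[LHS]/((Z_op T t x \o p) (q r)) -Wx Wx0 Z0.
- by rewrite -[spanned_by e]Ke.
rewrite -[spanned_by e]Ke => x Kx Wxy; exists x => //.
apply/funext => r; have [_ Wx] := WP _ Kx.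
by rewrite -(pq r) -[LHS]/((Z_op T t x \o p) (q r)) -Wx Wxy yu.
Qed.

End RegularFactorizations.

(** Every defect operator involved is 0, so the target of Z_s is zero. *)
Lemma symmetric_regular_isometric (R : realType) (H : hilbertType R) (k : nat)
    (T : 'I_k -> {linear H -> H}) :
  commuting T -> (forall i, isometric (T i)) -> symmetric_regular T.
Proof.
move=> Tcomm T1 s.
have T1' i : contractive (T i) by move=> x; rewrite T1.
have [Zs_iso Z_val] := Z_op_spec Tcomm T1' s; split => //.
have Tr i x : rnorm (T i x) = rnorm x by apply/eqr_rnorm; exact: T1.
move=> u us; exists (defect_op (prod_op T) 0).
  by apply: subset_closure; exists 0.
apply/funext => r; rewrite Z_val.
have lT : linear (T (s r)) by exact: linearP.
have cT x : rnorm (T (s r) x) <= rnorm x by rewrite Tr.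
rewrite (defect_op_isometric lT cT (Tr _)).
by rewrite (defect_space_isometric lT cT (Tr _) (us r)).
Qed.

(** * A zero operator next to a non-surjective isometry *)

Section Counterexample.
Context {R : realType} {H : hilbertType R}.
Variable S : {linear H -> H}.
Hypothesis S1 : isometric S.
Hypothesis Snsurj : exists y, forall x, S x != y.
Variable k : nat.
Hypothesis k2 : (2 <= k)%N.

Let k0 : (0 < k)%N := ltnW k2.
Let o : 'I_k := Ordinal k0.
Let last_lt : (k.-1 < k)%N. Proof. by rewrite prednK. Qed.
Let ilast : 'I_k := Ordinal last_lt.

Definition zero_map : {linear H -> H} := GRing.null_fun H.

(** Index 0 carries the zero operator and every other index the isometry S. The
    product is then 0, and its defect operator, a positive square root of the
    identity, is an involution. *)
Definition zero_isometry_tuple (i : 'I_k) : {linear H -> H} :=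
  if i == o then zero_map else S.

Local Notation T := zero_isometry_tuple.

Lemma zero_isometry_tupleE i x : T i x = if i == o then 0 else S x.
Proof. by rewrite /T; case: ifP. Qed.

Lemma zero_isometry_tuple_comm : commuting T.
Proof. by move=> i j x; rewrite !zero_isometry_tupleE; do 2?case: ifP => _; rewrite ?linear0. Qed.

Lemma zero_isometry_tuple_contractive i : contractive (T i).
Proof. by move=> x; rewrite zero_isometry_tupleE; case: ifP => _; rewrite ?normr0// S1. Qed.

Let T1 := zero_isometry_tuple_contractive.

Lemma prod_zero_isometry : prod_op T = T o.
Proof.
apply/funext => x; rewrite zero_isometry_tupleE eqxx (prod_opE zero_isometry_tuple_comm 1).
rewrite -[0%N]/(val o) tail_seq_step; last exact: zero_isometry_tuple_comm.
by rewrite /= perm1 zero_isometry_tupleE eqxx.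
Qed.

Local Notation D := (defect_op (T o)).

Lemma defect_zeroK x : D (D x) = x.
Proof.
have [|y|_ DD] := @defect_op_spec R H (T o); first exact: linearP.
  by rewrite -ler_rnorm; exact: T1.
apply: rinner_inj => y; rewrite ![rinner y _]rinnerC DD.
by rewrite zero_isometry_tupleE eqxx rinner0l subr0.
Qed.

Lemma rnorm_isometry_factor i x : i != o -> rnorm (T i x) = rnorm x.
Proof.
by move=> io; rewrite zero_isometry_tupleE (negPf io); apply/eqr_rnorm; exact: S1.
Qed.

Lemma defect_isometry_factor i x : i != o -> defect_op (T i) x = 0.
Proof.
move=> io; apply: defect_op_isometric; first exact: linearP.
  by move=> y; rewrite rnorm_isometry_factor.
by move=> y; exact: rnorm_isometry_factor.
Qed.

Lemma defect_space_isometry_factor i y : i != o -> defect_space (T i) y -> y = 0.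
Proof.
move=> io; apply: defect_space_isometric; first exact: linearP.
  by move=> x; rewrite rnorm_isometry_factor.
by move=> x; exact: rnorm_isometry_factor.
Qed.

Lemma defect_space_prodT : defect_space (prod_op T) = setT.
Proof.
apply/seteqP; split => // x _; apply: subset_closure.
by exists (D x) => //; rewrite prod_zero_isometry defect_zeroK.
Qed.

Lemma zero_isometry_infinite_dim : ~ finite_dim (defect_space (prod_op T)).
Proof.
rewrite defect_space_prodT => -[n [e eT]]; have [y yS] := Snsurj.
have inT x : spanned_by e x by rewrite -[spanned_by e]eT.
have [x _|c u v _ _|x _ Sx0||x _ Sxy] :=
    @spanned_by_injective_surjective _ _ _ e S _ _ _ y.
- exact: inT.
- exact: linearP.
- by apply/normr0_eq0; rewrite -S1 Sx0 normr0.
- exact: inT.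
by have := yS x; rewrite Sxy eqxx.
Qed.

(** The transposition puts the zero operator last, where no other operator is
    applied before it: Z_s (D h) has D h there and 0 elsewhere. *)
Lemma zero_isometry_regular : exists s : 'S_k, regular_factorization T s.
Proof.
pose s : 'S_k := tperm o ilast; exists s.
have [Z_iso Z_val] := Z_op_spec zero_isometry_tuple_comm T1 s; split => // u us.
have slast : s ilast = o by rewrite tpermR.
exists (u ilast); first by rewrite defect_space_prodT.
apply/funext => r; rewrite -{1}(defect_zeroK (u ilast)) -prod_zero_isometry Z_val.
have [->|rlast] := eqVneq r ilast.
  rewrite slast tail_opE /= prednK// tail_seq_end big_nil /=.
  by rewrite prod_zero_isometry defect_zeroK.
have sr : s r != o by rewrite -slast (inj_eq perm_inj).
by rewrite defect_isometry_factor// (defect_space_isometry_factor sr (us r)).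
Qed.

(** In the given order the zero operator comes first, and the component of
    Z (D h) there is D (S v) for some v; it avoids D y when y is not in the
    range of S, as D is injective. *)
Lemma zero_isometry_not_symmetric : ~ symmetric_regular T.
Proof.
move=> /(_ 1%g) [_ surj]; have [y yS] := Snsurj.
have [_ Z_val] := Z_op_spec zero_isometry_tuple_comm T1 1%g.
pose u (r : 'I_k) : H := if r == o then D y else 0.
have [|x _ xu] := surj u.
  move=> r; apply: subset_closure; rewrite perm1 /u.
  case: ifP => [/eqP ->|/negbT ro]; first by exists y.
  by exists 0 => //; rewrite defect_isometry_factor.
have := congr1 (@^~ o) xu; rewrite /u eqxx -(defect_zeroK x) -prod_zero_isometry Z_val.
rewrite prod_zero_isometry perm1 tail_opE => /(congr1 D); rewrite !defect_zeroK.
pose o1 : 'I_k := Ordinal k2.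
rewrite -[(val o).+1]/(val o1) tail_seq_step; last exact: zero_isometry_tuple_comm.
rewrite /= perm1 zero_isometry_tupleE /= => Sy.
by move: Sy; apply/eqP; exact: yS.
Qed.

End Counterexample.

(** * The Hilbert space of square-summable sequences *)

Section SquareSummable.
Context {R : realType}.
Implicit Types (z w : R[i]) (f g h : nat -> R[i]).

(** The real part of z times the conjugate of w. *)
Definition cdot z w : R :=
  complex.Re z * complex.Re w + complex.Im z * complex.Im w.

Definition sqsum f n : R := \sum_(i < n) cdot (f i) (f i).

Definition sqsummable f : Prop := exists M, forall n, sqsum f n <= M.

Lemma cdot_ge0 z : 0 <= cdot z z.
Proof. by rewrite /cdot -!expr2 addr_ge0 ?sqr_ge0. Qed.

Lemma cdot_eq0 z : cdot z z = 0 -> z = 0.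
Proof.
case: z => a b; rewrite /cdot/= => ab; have a2 := sqr_ge0 a; have b2 := sqr_ge0 b.
have /eqP : a ^+ 2 = 0 by lra.
have /eqP : b ^+ 2 = 0 by lra.
by rewrite !sqrf_eq0 => /eqP -> /eqP ->.
Qed.

Lemma sqsumS f n : sqsum f n.+1 = sqsum f n + cdot (f n) (f n).
Proof. by rewrite /sqsum big_ord_recr. Qed.

Lemma sqsum_le f m n : (m <= n)%N -> sqsum f m <= sqsum f n.
Proof.
move=> mn; apply: (@homo_leq _ (sqsum f) <=%O) mn => //; first exact: le_trans.
by move=> {}n; rewrite sqsumS lerDl cdot_ge0.
Qed.

Lemma sqsum_ge0 f n : 0 <= sqsum f n.
Proof. by apply: sumr_ge0 => i _; exact: cdot_ge0. Qed.

Lemma sqsummableD f g : sqsummable f -> sqsummable g -> sqsummable (fun i => f i + g i).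
Proof.
move=> [M fM] [N gN]; exists (2 * M + 2 * N) => n.
apply: le_trans (_ : 2 * sqsum f n + 2 * sqsum g n <= _).
  rewrite /sqsum !mulr_sumr -big_split/=; apply: ler_sum => i _.
  case: (f i) (g i) => a b [c d]; rewrite /cdot/=.
  by have := sqr_ge0 (a - c); have := sqr_ge0 (b - d); nra.
by have := fM n; have := gN n; lra.
Qed.

Lemma sqsummableZ (a : R[i]) f : sqsummable f -> sqsummable (fun i => a * f i).
Proof.
move=> [M fM]; exists (cdot a a * M) => n.
apply: le_trans (_ : cdot a a * sqsum f n <= _); last by rewrite ler_wpM2l ?cdot_ge0.
rewrite /sqsum mulr_sumr; apply: ler_sum => i _.
by case: a (f i) => a b [c d]; rewrite /cdot/=; nra.
Qed.

Lemma sqsummable_eventually0 f N : (forall i, (N <= i)%N -> f i = 0) -> sqsummable f.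
Proof.
move=> f0; exists (sqsum f N) => n.
have [nN|Nn] := leqP n N; first exact: sqsum_le.
rewrite -(subnKC (ltnW Nn)); elim: (n - N)%N => [|m IH]; first by rewrite addn0.
by rewrite addnS sqsumS f0 ?leq_addr// /cdot /= !mulr0 !addr0.
Qed.

Lemma sqsummable_cvg f : sqsummable f -> cvgn (sqsum f).
Proof.
move=> [M fM]; apply: nondecreasing_is_cvgn.
  by move=> m n; exact: sqsum_le.
by exists M => _ [n _ <-].
Qed.

End SquareSummable.

Record l2 (R : realType) := L2 {
  l2_coord :> nat -> R[i];
  l2_sqsummable : sqsummable l2_coord }.

Section L2Module.
Context {R : realType}.
Implicit Types (a b : R[i]) (f g h : l2 R).

Lemma l2_ext f g : (forall i, f i = g i) -> f = g.
Proof.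
case: f g => [f fP] [g gP]/= /funext fg; move: gP; rewrite -fg => gP.
by congr L2; exact: Prop_irrelevance.
Qed.

HB.instance Definition _ := gen_eqMixin (l2 R).
HB.instance Definition _ := gen_choiceMixin (l2 R).

Definition l2_zero : l2 R :=
  L2 (@sqsummable_eventually0 R (fun=> 0) 0 (fun _ _ => erefl)).
Definition l2_add f g : l2 R := L2 (sqsummableD (l2_sqsummable f) (l2_sqsummable g)).
Definition l2_scale a f : l2 R := L2 (sqsummableZ a (l2_sqsummable f)).
Definition l2_opp f : l2 R := l2_scale (-1) f.

Fact l2_addA : associative l2_add.
Proof. by move=> f g h; apply: l2_ext => i /=; rewrite addrA. Qed.
Fact l2_addC : commutative l2_add.
Proof. by move=> f g; apply: l2_ext => i /=; rewrite addrC. Qed.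
Fact l2_add0 : left_id l2_zero l2_add.
Proof. by move=> f; apply: l2_ext => i /=; rewrite add0r. Qed.
Fact l2_addN : left_inverse l2_zero l2_opp l2_add.
Proof. by move=> f; apply: l2_ext => i /=; rewrite mulN1r addNr. Qed.

HB.instance Definition _ :=
  GRing.isZmodule.Build (l2 R) l2_addA l2_addC l2_add0 l2_addN.

Fact l2_scaleA a b f : l2_scale a (l2_scale b f) = l2_scale (a * b) f.
Proof. by apply: l2_ext => i /=; rewrite mulrA. Qed.
Fact l2_scale1 : left_id 1 l2_scale.
Proof. by move=> f; apply: l2_ext => i /=; rewrite mul1r. Qed.
Fact l2_scaleDr : right_distributive l2_scale +%R.
Proof. by move=> a f g; apply: l2_ext => i /=; rewrite mulrDr. Qed.
Fact l2_scaleDl f : {morph l2_scale^~ f : a b / a + b}.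
Proof. by move=> a b; apply: l2_ext => i /=; rewrite mulrDl. Qed.

HB.instance Definition _ := GRing.Zmodule_isLmodule.Build R[i] (l2 R)
  l2_scaleA l2_scale1 l2_scaleDr l2_scaleDl.

Lemma l2_coordD f g i : (f + g) i = f i + g i. Proof. by []. Qed.
Lemma l2_coordZ a f i : (a *: f) i = a * f i. Proof. by []. Qed.
Lemma l2_coordN f i : (- f) i = - f i. Proof. exact: mulN1r. Qed.
Lemma l2_coordB f g i : (f - g) i = f i - g i.
Proof. by rewrite l2_coordD l2_coordN. Qed.

Definition l2_dot f g : R := limn (fun n => \sum_(i < n) cdot (f i) (g i)).

(** Polarization writes the partial sums of the inner product in terms of those
    of squared norms, which converge because they increase and are bounded. *)
Lemma l2_dotP f g : \sum_(i < n) cdot (f i) (g i) @[n --> \oo] --> l2_dot f g.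
Proof.
have /cvg_ex[/= l cfg] := sqsummable_cvg (l2_sqsummable (f + g)).
have /cvg_ex[/= lf cf] := sqsummable_cvg (l2_sqsummable f).
have /cvg_ex[/= lg cg] := sqsummable_cvg (l2_sqsummable g).
apply: (@cvgP _ _ (2^-1 * (l - lf - lg))).
have -> : (fun n => \sum_(i < n) cdot (f i) (g i)) =
    (fun n => 2^-1 * (sqsum (f + g) n - sqsum f n - sqsum g n)).
  apply/funext => n; rewrite /sqsum -!sumrB mulr_sumr; apply: eq_bigr => i _.
  by rewrite l2_coordD; case: (f i) (g i) => x y [z w]; rewrite /cdot/=; field.
by apply: cvgM; [exact: cvg_cst|apply: cvgB => //; exact: cvgB].
Qed.

(** All algebraic rules for the inner product follow termwise from this one. *)
Lemma l2_dot_lin (x y : R) f g f1 g1 f2 g2 :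
  (forall i, cdot (f i) (g i) = x * cdot (f1 i) (g1 i) + y * cdot (f2 i) (g2 i)) ->
  l2_dot f g = x * l2_dot f1 g1 + y * l2_dot f2 g2.
Proof.
move=> e.
have lim2 : \sum_(i < n) cdot (f i) (g i) @[n --> \oo] -->
    x * l2_dot f1 g1 + y * l2_dot f2 g2.
  have -> : (fun n => \sum_(i < n) cdot (f i) (g i)) = (fun n =>
      x * (\sum_(i < n) cdot (f1 i) (g1 i)) + y * (\sum_(i < n) cdot (f2 i) (g2 i))).
    apply/funext => n; rewrite !mulr_sumr -big_split/=.
    by apply: eq_bigr => i _; exact: e.
  by apply: cvgD; apply: cvgM; (try exact: cvg_cst); exact: l2_dotP.
exact: (cvg_unique (@Rhausdorff R) (@l2_dotP f g) lim2).
Qed.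

Lemma l2_dotC f g : l2_dot f g = l2_dot g f.
Proof.
rewrite (@l2_dot_lin 1 0 f g g f g f) ?mul1r ?mul0r ?addr0// => i.
by rewrite mul1r mul0r addr0 /cdot; ring.
Qed.

Lemma l2_dotDl f g h : l2_dot (f + g) h = l2_dot f h + l2_dot g h.
Proof.
rewrite (@l2_dot_lin 1 1 (f + g) h f h g h) ?mul1r// => i.
by rewrite !mul1r /cdot l2_coordD !raddfD/=; ring.
Qed.

Lemma l2_dotZl a f h :
  l2_dot (a *: f) h = complex.Re a * l2_dot f h - complex.Im a * l2_dot f ('i *: h).
Proof.
rewrite -mulNr; apply: l2_dot_lin => i.
by rewrite !l2_coordZ; case: a (f i) (h i) => x y [u v] [p q]; rewrite /cdot/=; ring.
Qed.

Lemma l2_dot_iC f g : l2_dot f ('i *: g) = - l2_dot g ('i *: f).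
Proof.
rewrite (@l2_dot_lin (-1) 0 f ('i *: g) g ('i *: f) g f) ?mul0r ?addr0 ?mulN1r// => i.
by rewrite !l2_coordZ; case: (f i) (g i) => x y [u v]; rewrite /cdot/=; ring.
Qed.

Lemma l2_dotff f : sqsum f n @[n --> \oo] --> l2_dot f f.
Proof. exact: l2_dotP. Qed.

Lemma sqsum_le_dot f n : sqsum f n <= l2_dot f f.
Proof.
have := @l2_dotff f => /cvg_lim <-//; apply: nondecreasing_cvgn_le.
  by move=> p q; exact: sqsum_le.
exact: sqsummable_cvg (l2_sqsummable f).
Qed.

Lemma l2_dot_le f (M : R) : (forall n, sqsum f n <= M) -> l2_dot f f <= M.
Proof.
move=> fM; apply: (cvgr_to_le (@l2_dotff f)).
exact: nearW.
Qed.

Lemma l2_dot_ge0 f : 0 <= l2_dot f f.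
Proof. exact: le_trans (sqsum_ge0 f 0) (sqsum_le_dot f 0). Qed.

Lemma l2_dot_eq0 f : l2_dot f f = 0 -> f = 0.
Proof.
move=> f0; apply: l2_ext => i; apply: cdot_eq0; apply/eqP.
rewrite eq_le cdot_ge0 andbT -f0; apply: le_trans (sqsum_le_dot f i.+1).
by rewrite sqsumS lerDr sqsum_ge0.
Qed.

Definition l2_norm f : R := Num.sqrt (l2_dot f f).

Lemma l2_norm_ge0 f : 0 <= l2_norm f. Proof. exact: sqrtr_ge0. Qed.

Lemma l2_norm_sqr f : l2_norm f ^+ 2 = l2_dot f f.
Proof. by rewrite sqr_sqrtr// l2_dot_ge0. Qed.

Lemma l2_dotZl_real (x : R) f h : l2_dot (x%:C *: f) h = x * l2_dot f h.
Proof. by rewrite l2_dotZl /= mul0r subr0. Qed.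

(** Expand the square of |g| f - |f| g, which is nonnegative. *)
Lemma l2_cauchy_schwarz f g : l2_dot f g <= l2_norm f * l2_norm g.
Proof.
have [f0|f0] := eqVneq (l2_norm f) 0.
  have -> : f = 0 by apply: l2_dot_eq0; rewrite -l2_norm_sqr f0 expr0n.
  have -> : l2_dot 0 g = 0 by rewrite -(scale0r f) (l2_dotZl_real 0) mul0r.
  by rewrite mulr_ge0 ?l2_norm_ge0.
have [g0|g0] := eqVneq (l2_norm g) 0.
  have -> : g = 0 by apply: l2_dot_eq0; rewrite -l2_norm_sqr g0 expr0n.
  have -> : l2_dot f 0 = 0.
    by rewrite l2_dotC -(scale0r f) (l2_dotZl_real 0) mul0r.
  by rewrite mulr_ge0 ?l2_norm_ge0.
have fp : 0 < l2_norm f by rewrite lt_def f0 l2_norm_ge0.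
have gp : 0 < l2_norm g by rewrite lt_def g0 l2_norm_ge0.
set a := l2_norm f in f0 fp *; set b := l2_norm g in g0 gp *.
have := l2_dot_ge0 (b%:C *: f + (- a)%:C *: g).
rewrite l2_dotDl !l2_dotZl_real ![l2_dot _ (_ + _)]l2_dotC !l2_dotDl !l2_dotZl_real.
rewrite (l2_dotC g f) -!l2_norm_sqr -/a -/b => h.
have ab : 0 < a * b by exact: mulr_gt0.
rewrite -(ler_pM2l ab); nra.
Qed.

Lemma l2_normD f g : l2_norm (f + g) <= l2_norm f + l2_norm g.
Proof.
rewrite -ler_sqr ?nnegrE ?addr_ge0 ?l2_norm_ge0// l2_norm_sqr.
rewrite l2_dotDl ![l2_dot _ (_ + _)]l2_dotC !l2_dotDl (l2_dotC g f).
rewrite -!l2_norm_sqr.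
by have := l2_cauchy_schwarz f g; lra.
Qed.

Definition l2_cnorm f : R[i] := (l2_norm f)%:C.

Fact l2_cnormD f g : l2_cnorm (f + g) <= l2_cnorm f + l2_cnorm g.
Proof. by rewrite -rmorphD/= lecR l2_normD. Qed.

Fact l2_cnormZ a f : l2_cnorm (a *: f) = `|a| * l2_cnorm f.
Proof.
rewrite normc_def -rmorphM/= /l2_cnorm /l2_norm -sqrtrM ?addr_ge0 ?sqr_ge0//.
congr (Num.sqrt _)%:C; rewrite -[RHS]addr0 -(mul0r (l2_dot f f)).
apply: l2_dot_lin => i; rewrite !l2_coordZ mul0r addr0.
by case: a (f i) => x y [u v]; rewrite /cdot/=; ring.
Qed.

Fact l2_cnorm_eq0 f : l2_cnorm f = 0 -> f = 0.
Proof.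
by move=> /complexI f0; apply: l2_dot_eq0; rewrite -l2_norm_sqr f0 expr0n.
Qed.

HB.instance Definition _ := Lmodule_isNormed.Build R[i] (l2 R)
  l2_cnormD l2_cnormZ l2_cnorm_eq0.

Lemma l2_normE f : `|f| = (l2_norm f)%:C. Proof. by []. Qed.

End L2Module.

Section L2Hilbert.
Context {R : realType}.
Implicit Types (a b : R[i]) (f g h : l2 R).

(** The imaginary part is Re <f, i g>, as the inner product is conjugate-linear
    in its second argument. *)
Definition l2_inner f g : R[i] := l2_dot f g +i* l2_dot f ('i *: g).

Lemma l2_scale_ii f : 'i *: ('i *: f) = - f.
Proof. by rewrite scalerA -expr2 sqr_i scaleN1r. Qed.

Lemma l2_innerC f g : l2_inner f g = (l2_inner g f)^*.
Proof. by rewrite /l2_inner /= l2_dotC l2_dot_iC. Qed.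

Lemma l2_innerPl h : GRing.linear_for *%R (l2_inner^~ h).
Proof.
move=> [x y] f g; rewrite /l2_inner !l2_dotDl !l2_dotZl /= l2_scale_ii.
have -> : l2_dot f (- h) = - l2_dot f h.
  by rewrite -scaleN1r l2_dotC l2_dotZl /= oppr0 mul0r subr0 mulN1r l2_dotC.
by apply/eqP; rewrite eq_complex /=; apply/andP; split; apply/eqP; ring.
Qed.

Lemma l2_innerPr h : GRing.linear_for (@Num.conj R[i] \; *%R) (l2_inner h).
Proof.
move=> x f g; rewrite l2_innerC l2_innerPl rmorphD rmorphM /=.
by rewrite (l2_innerC h f) (l2_innerC h g).
Qed.

HB.instance Definition _ := bilinear_isBilinear.Build R[i] (l2 R) (l2 R) R[i]
  *%R (@Num.conj R[i] \; *%R) l2_inner (l2_innerPl, l2_innerPr).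

Fact l2_inner_hermitian f g : l2_inner f g = (-1) ^+ false * Num.conj (l2_inner g f).
Proof. by rewrite expr0 mul1r l2_innerC. Qed.

HB.instance Definition _ := isHermitianSesquilinear.Build R[i] (l2 R) false
  (@Num.conj R[i]) l2_inner l2_inner_hermitian.

Lemma l2_innerff f : l2_inner f f = `|f| ^+ 2.
Proof.
rewrite l2_normE -rmorphXn/= l2_norm_sqr /l2_inner.
have := l2_dot_iC f f => e; have -> : l2_dot f ('i *: f) = 0 by lra.
by [].
Qed.

Fact l2_inner_gt0 f : f != 0 -> 0 < l2_inner f f.
Proof. by move=> f0; rewrite l2_innerff exprn_gt0// normr_gt0. Qed.

HB.instance Definition _ := isDotProduct.Build R[i] (l2 R) l2_inner l2_inner_gt0.

Lemma l2_ball f (e : R) g : ball f e%:C g <-> l2_norm (f - g) < e.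
Proof. by rewrite -ball_normE /ball_/= l2_normE ltcR. Qed.

Lemma l2_coord_le f i : cdot (f i) (f i) <= l2_norm f ^+ 2.
Proof.
rewrite l2_norm_sqr; apply: le_trans (sqsum_le_dot f i.+1).
by rewrite sqsumS lerDr sqsum_ge0.
Qed.

Lemma l2_Re_le f i : `|complex.Re (f i)| <= l2_norm f.
Proof.
rewrite -ler_sqr ?nnegrE ?l2_norm_ge0// real_normK ?num_real//.
by apply: le_trans (l2_coord_le f i); rewrite /cdot -expr2 lerDl -expr2 sqr_ge0.
Qed.

Lemma l2_Im_le f i : `|complex.Im (f i)| <= l2_norm f.
Proof.
rewrite -ler_sqr ?nnegrE ?l2_norm_ge0// real_normK ?num_real//.
by apply: le_trans (l2_coord_le f i); rewrite /cdot -!expr2 lerDr sqr_ge0.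
Qed.

Lemma l2_proj_cvg (p : l2 R -> R) (F : set_system (l2 R)) :
  ProperFilter F -> cauchy F ->
  (forall f g, `|p f - p g| <= l2_norm (f - g)) ->
  exists l : R, p x @[x --> F] --> l.
Proof.
move=> FF /cauchyP Fc pl; apply/cvg_ex; apply: cauchy_cvg.
apply: cauchy_exP => e e0.
have [|f Ff] := Fc e%:C; first by rewrite ltcR.
exists (p f); suff : F [set g | ball (p f) e (p g)] by [].
apply: filterS Ff => g /l2_ball fg.
by rewrite -ball_normE; exact: le_lt_trans (pl f g) fg.
Qed.

(** Coordinates of a Cauchy filter converge. If the filter contains the ball of
    radius e around g, every partial sum of |g - f|^2 is at most e^2 for f in
    that ball, and letting f converge coordinatewise bounds those of |g - l|^2.
    So the coordinatewise limit l is square-summable and within e of g. *)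
Fact l2_complete (F : set_system (l2 R)) : ProperFilter F -> cauchy F -> cvg F.
Proof.
move=> FF Fc.
have /choice[lR lRP] i : exists l : R, (fun f : l2 R => complex.Re (f i)) @ F --> l.
  apply: (@l2_proj_cvg (fun f => complex.Re (f i))) => // f g.
  by rewrite -raddfB -l2_coordB l2_Re_le.
have /choice[lI lIP] i : exists l : R, (fun f : l2 R => complex.Im (f i)) @ F --> l.
  apply: (@l2_proj_cvg (fun f => complex.Im (f i))) => // f g.
  by rewrite -raddfB -l2_coordB l2_Im_le.
pose l i : R[i] := lR i +i* lI i.
have near_l (e : R) : 0 < e -> exists2 g : l2 R, F (ball g e%:C) &
    forall n, sqsum (fun i => g i - l i) n <= e ^+ 2.
  move=> e0; have /cauchyP/(_ e%:C) [|g Fg] := Fc; first by rewrite ltcR.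
  exists g => // n.
  have lim : sqsum (g - f) n @[f --> F] --> sqsum (fun i => g i - l i) n.
    apply: cvg_big => [|i _]; first exact: add_continuous.
    rewrite /cdot.
    have -> : complex.Re (g i - l i) = complex.Re (g i) - lR i by case: (g i).
    have -> : complex.Im (g i - l i) = complex.Im (g i) - lI i by case: (g i).
    under eq_fun do rewrite l2_coordB !raddfB/=.
    by apply: cvgD; apply: cvgM; apply: cvgB => //; exact: cvg_cst.
  apply: (cvgr_to_le lim).
  apply: filterS Fg => f /l2_ball /ltW gf; apply: le_trans (sqsum_le_dot _ n) _.
  by rewrite -l2_norm_sqr ler_sqr ?nnegrE ?l2_norm_ge0// ltW.
have l_sqsummable : sqsummable l.
  have [g _ gl] := near_l 1 ltr01.
  have gl' : sqsummable (fun i => g i - l i) by exists (1 ^+ 2).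
  have := sqsummableD (l2_sqsummable g) (sqsummableZ (-1) gl').
  by congr sqsummable; apply/funext => i /=; rewrite mulN1r opprB addrC subrK.
apply/cvg_ex; exists (L2 l_sqsummable); apply/cvg_ballP => -[e e'].
rewrite ltcE/= => /andP[/eqP -> e0].
have [g Fg gl] := near_l (e / 2) (divr_gt0 e0 (ltr0Sn _ 1)).
apply: filterS Fg => f /l2_ball gf; apply/l2_ball.
have lg : l2_norm (g - L2 l_sqsummable) <= e / 2.
  rewrite -ler_sqr ?nnegrE ?l2_norm_ge0 ?divr_ge0 ?(ltW e0)// l2_norm_sqr.
  apply: l2_dot_le => n; apply: le_trans (gl n); rewrite le_eqVlt; apply/orP; left.
  by apply/eqP/eq_bigr => i _; rewrite l2_coordB.
have := l2_normD (L2 l_sqsummable - g) (g - f); rewrite subrKA.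
have -> : l2_norm (L2 l_sqsummable - g) = l2_norm (g - L2 l_sqsummable).
  by apply: complexI; rewrite -!l2_normE distrC.
by lra.
Qed.

HB.instance Definition _ := Uniform_isComplete.Build (l2 R) l2_complete.

HB.instance Definition _ := NormedModule_isHilbert.Build R (l2 R) (fun f => esym (l2_innerff f)).

Definition l2_hilbert : hilbertType R := l2 R.

End L2Hilbert.

Section L2Separable.
Context {R : realType}.
Implicit Types f g : l2 R.

Definition rat_complex (q : rat * rat) : R[i] := ratr q.1 +i* ratr q.2.

Fact rat_seq_eventually0 (s : seq (rat * rat)) i :
  (size s <= i)%N -> rat_complex (nth (0, 0) s i) = 0.
Proof. by move=> si; rewrite nth_default// /rat_complex/= rmorph0. Qed.

Definition rat_seq (s : seq (rat * rat)) : l2 R :=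
  L2 (sqsummable_eventually0 (@rat_seq_eventually0 s)).

Lemma rat_complex_dense (z : R[i]) (e : R) : 0 < e ->
  exists q, cdot (z - rat_complex q) (z - rat_complex q) <= e.
Proof.
move=> e0; pose d := Num.sqrt (e / 2).
have d2 : d ^+ 2 = e / 2 by rewrite sqr_sqrtr// divr_ge0// ltW.
have d0 : 0 < d by rewrite sqrtr_gt0 divr_gt0.
have approx (x : R) : exists q : rat, (x - ratr q) ^+ 2 <= e / 2.
  have [|q] := @rat_in_itvoo R (x - d) (x + d); first by lra.
  rewrite in_itv/= => /andP[q1 q2]; exists q.
  rewrite -d2.
  have : 0 <= (d - (x - ratr q)) * (d + (x - ratr q)) by apply: mulr_ge0; lra.
  by lra.
case: z => x y; have [[p px] [q qy]] := (approx x, approx y).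
by exists (p, q); rewrite /cdot/= -!expr2; lra.
Qed.

(** Approximate the first N coordinates of f by rationals so that they
    contribute at most e^2 / 2 to the squared distance, where N is such that the
    remaining ones contribute less than e^2 / 2. *)
Lemma rat_seq_dense : dense (range rat_seq).
Proof.
move=> O [f Of] Oop.
have /nbhs_ballP[[e e']] : nbhs f O by exact: open_nbhs_nbhs.
rewrite /= ltcE/= => /andP[/eqP -> e0] fO.
have e20 : 0 < e ^+ 2 / 2 by rewrite divr_gt0// exprn_gt0.
have /cvgrPdist_lt/(_ _ e20)[N _ /(_ N (leqnn N))] := @l2_dotff R f.
rewrite /= ger0_norm ?subr_ge0 ?sqsum_le_dot// => tail.
pose d : R := e ^+ 2 / 2 / N.+1%:R.
have d0 : 0 < d by rewrite divr_gt0.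
have /choice[q qP] i := rat_complex_dense (f i) d0.
exists (rat_seq (mkseq q N)); split; last by exists (mkseq q N).
apply/fO/l2_ball; rewrite -ltr_sqr ?nnegrE ?l2_norm_ge0 ?(ltW e0)// l2_norm_sqr.
set g := rat_seq _.
have gN i : (i < N)%N -> (f - g) i = f i - rat_complex (q i).
  by move=> iN; rewrite l2_coordB /g /= nth_mkseq.
have gN' i : (N <= i)%N -> (f - g) i = f i.
  move=> Ni; rewrite l2_coordB /g /= (@rat_seq_eventually0 (mkseq q N)) ?subr0//.
  by rewrite size_mkseq.
have headN : sqsum (f - g) N <= N%:R * d.
  rewrite mulr_natl -[X in d *+ X]card_ord -sumr_const.
  by apply: ler_sum => i _; rewrite gN.
have sum_le m : sqsum (f - g) (N + m) <= N%:R * d + (sqsum f (N + m) - sqsum f N).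
  elim: m => [|m IH]; first by rewrite addn0 subrr addr0.
  rewrite addnS !sqsumS gN' ?leq_addr//.
  by move: IH; lra.
have Nd : N%:R * d <= e ^+ 2 / 2.
  rewrite /d mulrCA -[leRHS]mulr1 ler_pM2l// ler_pdivrMr// mul1r.
  by rewrite ler_nat.
apply: le_lt_trans (_ : N%:R * d + (l2_dot f f - sqsum f N) < _).
  apply: l2_dot_le => n; apply: le_trans (sqsum_le _ (leq_addl N n)) _.
  by apply: le_trans (sum_le n) _; rewrite lerD2l lerD2r sqsum_le_dot.
by move: tail Nd; lra.
Qed.

Lemma l2_separable : separable_space (l2_hilbert : hilbertType R).
Proof.
exists (range rat_seq); last exact: rat_seq_dense.
by apply: card_le_trans (card_image_le _ _) _; exact: countableP.
Qed.

End L2Separable.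

(** * The unilateral shift *)

Section Shift.
Context {R : realType}.
Implicit Types f g : l2 R.

Definition shift_coord f i : R[i] := if i is j.+1 then f j else 0.

Lemma sqsum_shift f n : sqsum (shift_coord f) n.+1 = sqsum f n.
Proof. by rewrite /sqsum big_ord_recl/= /cdot/= !mulr0 !add0r. Qed.

Fact shift_sqsummable f : sqsummable (shift_coord f).
Proof.
have [M fM] := l2_sqsummable f; exists M => n.
by apply: le_trans (sqsum_le _ (leqnSn n)) _; rewrite sqsum_shift.
Qed.

Definition l2_shift f : l2 R := L2 (shift_sqsummable f).

Fact l2_shift_linear : linear l2_shift.
Proof. by move=> a f g; apply: l2_ext => -[|i] //=; rewrite mulr0 addr0. Qed.

HB.instance Definition _ := GRing.isLinear.Build R[i] (l2 R) (l2 R) *:%R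
  l2_shift l2_shift_linear.

Lemma l2_shift_norm f : `|l2_shift f| = `|f|.
Proof.
rewrite !l2_normE /l2_norm; congr (Num.sqrt _)%:C; apply/le_anti/andP; split.
  apply: l2_dot_le => n; apply: le_trans (sqsum_le _ (leqnSn n)) _.
  by rewrite sqsum_shift sqsum_le_dot.
by apply: l2_dot_le => n; rewrite -sqsum_shift; exact: (sqsum_le_dot (l2_shift f)).
Qed.

Lemma l2_shift_not_surjective : exists g : l2 R, forall f, l2_shift f != g.
Proof.
exists (rat_seq [:: (1, 0)]) => f; apply/eqP => /(congr1 (fun h : l2 R => h 0%N)).
by move/eqP; rewrite eq_complex /= rmorph1 eq_sym oner_eq0.
Qed.

End Shift.

Theorem theorem5p1 (R : realType) (k : nat) (hk : (2 <= k)%N) :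
  [/\ (forall (H : hilbertType R) (T : 'I_k -> {linear H -> H}),
         separable_space H ->
         commuting T ->
         (forall i, contractive (T i)) ->
         finite_dim (defect_space (prod_op T)) ->
         (exists s : 'S_k, regular_factorization T s) ->
         symmetric_regular T),
      (exists (H : hilbertType R) (T : 'I_k -> {linear H -> H}),
         [/\ separable_space H,
             commuting T,
             (forall i, contractive (T i)),
             ~ finite_dim (defect_space (prod_op T))
           & (exists s : 'S_k, regular_factorization T s) /\
             ~ symmetric_regular T])
    & (forall (H : hilbertType R) (T : 'I_k -> {linear H -> H}),
         separable_space H ->
         commuting T ->
         (forall i, isometric (T i)) ->
         symmetric_regular T)].
Proof.
split.
- move=> H T _ Tcomm T1 fin [s sreg] t.
  exact: regular_factorization_finite_dim sreg.
- pose S : {linear (l2_hilbert : hilbertType R) -> (l2_hilbert : hilbertType R)} :=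
    l2_shift : {linear l2 R -> l2 R}.
  have S1 : isometric S by exact: l2_shift_norm.
  have Sns : exists y, forall x, S x != y by exact: l2_shift_not_surjective.
  exists l2_hilbert, (zero_isometry_tuple S hk); split.
  + exact: l2_separable.
  + exact: zero_isometry_tuple_comm.
  + exact: zero_isometry_tuple_contractive.
  + exact: zero_isometry_infinite_dim.
  + by split; [exact: zero_isometry_regular|exact: zero_isometry_not_symmetric].
- by move=> H T _ Tcomm T1; exact: symmetric_regular_isometric.
Qed.
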